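(* Let $N\ge 1$, let $\varepsilon>0$, let $g\in\mathcal{B}_0(\mathbb{D}^N)$ and let $\varphi\in C(\mathbb{T}^N)$. There exist a measurable set $E\subset\mathbb{T}^N$ with $\sigma_N(E)\ge 1-\varepsilon$ and a polynomial $f$, such that (1) $\|f-g\|_{\mathcal{B}(\mathbb{D}^N)}\le\varepsilon$; (2) $\|f-\varphi\|_{\infty,E}\le\varepsilon$.
   Context: $\mathbb{D}$ is the open unit disc, $\mathbb{T}$ the unit circle, $\mathbb{D}^N$ the polydisc in $\mathbb{C}^N$ and $\mathbb{T}^N$ its distinguished boundary. $\sigma_N$ is the normalised Lebesgue measure on $\mathbb{T}^N$ (the $N$-fold product of the normalised Lebesgue measure on $\mathbb{T}$). $C(\mathbb{T}^N)$ is the space of continuous complex-valued functions on $\mathbb{T}^N$, and $\|h\|_{\infty,E}=\sup_{z\in E}|h(z)|$. ''Polynomial'' means holomorphic polynomial in $N$ complex variables. The Bloch space $\mathcal{B}(\mathbb{D}^N)$ is the Banach space of holomorphic $f$ on $\mathbb{D}^N$ with $\|f\|_{\mathcal{B}(\mathbb{D}^N)}:=|f(0)|+\sup_{z\in\mathbb{D}^N}\sum_{k=1}^N(1-|z_k|^2)\left|\frac{\partial f}{\partial z_k}(z)\right|<\infty$. The little Bloch space $\mathcal{B}_0(\mathbb{D}^N)$ is the closure of the set of all polynomials in $\mathcal{B}(\mathbb{D}^N)$. *)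

(* Defs.v *)
(* MathComp-Analysis, over an abstract [R : realType]; the complex numbers are
   [R[i]] from mathcomp-real-closed and points of C^N are row vectors. *)
From HB Require Import structures.
From mathcomp Require Import all_boot all_order all_algebra.
From mathcomp Require Import complex.
From mathcomp Require Import all_classical all_reals all_analysis.
From mathcomp Require Import measurable_realfun.
(* Not imported: its notations clash with those of MathComp-Analysis. *)
From mathcomp Require mpoly.

Set Implicit Arguments.
Unset Strict Implicit.
Unset Printing Implicit Defensive.

Import Order.TTheory GRing.Theory Num.Theory.
Import numFieldNormedType.Exports.
Import Normc.

Local Open Scope classical_set_scope.
Local Open Scope ring_scope.

(* R[i] as a normed space over itself, as MathComp-Analysis does for an
   abstract numClosedFieldType.  Differentiability of a map 'rV[R[i]]_N -> R[i]
   is therefore complex differentiability. *)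
#[warnings="-redundant-canonical-projection"]
HB.instance Definition _ (R : realType) := GRing.ComAlgebra.copy R[i] R[i]^o.
#[warnings="-redundant-canonical-projection"]
HB.instance Definition _ (R : realType) := Vector.copy R[i] R[i]^o.
#[warnings="-redundant-canonical-projection"]
HB.instance Definition _ (R : realType) := NormedModule.copy R[i] R[i]^o.

(* Borel sets of R[i]. *)
#[warnings="-redundant-canonical-projection"]
HB.instance Definition _ (R : realType) :=
  Measurable.copy R[i] (g_sigma_algebraType (@open R[i])).

(* Product of the Borel sigma-algebras on C^n, as for [n.-tuple] in the
   library. *)
Section measurable_rV.
Context (R : realType) (n : nat).

Let coord (i : 'I_n) (z : 'rV[R[i]]_n) : R[i] := z 0 i.

Let rV_set0 : g_sigma_preimage coord set0.
Proof. exact: sigma_algebra0. Qed.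

Let rV_setC A : g_sigma_preimage coord A -> g_sigma_preimage coord (~` A).
Proof. exact: sigma_algebraC. Qed.

Let rV_bigcup (F : (set 'rV[R[i]]_n)^nat) :
  (forall i, g_sigma_preimage coord (F i)) ->
  g_sigma_preimage coord (\bigcup_i (F i)).
Proof. exact: sigma_algebra_bigcup. Qed.

#[warnings="-redundant-canonical-projection"]
HB.instance Definition _ :=
  @isMeasurable.Build (measure_tuple_display (sigma_display (@open R[i])))
    'rV[R[i]]_n (g_sigma_preimage coord) rV_set0 rV_setC rV_bigcup.

End measurable_rV.

Section circle.
Context (R : realType).

(* t |-> exp (2 pi i t) *)
Definition circle_map (t : R) : R[i] :=
  Complex (cos (2 * pi * t)) (sin (2 * pi * t)).

Lemma continuous_real_complex : continuous (fun x : R => x%:C%C).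
Proof.
move=> x; apply/cvgrPdist_lt => e; rewrite ltcE/= => /andP[/eqP e0 e1].
near=> y.
rewrite -rmorphB normc_def/= expr0n/= addr0 sqrtr_sqr ltcE/= e0 eqxx/=.
near: y; exact: (@cvgr_dist_lt _ _ _ (nbhs x) _ id x).
Unshelve. all: by end_near. Qed.

Lemma continuous_circle_map : continuous circle_map.
Proof.
have -> : circle_map = (fun t => (cos (2 * pi * t))%:C%C +
    'i%C * (sin (2 * pi * t))%:C%C).
  by apply/funext => t; rewrite /circle_map; simpc.
have cC (h : R -> R) :
    continuous h -> continuous (fun t => (h (2 * pi * t))%:C%C : R[i]).
  move=> ch t; apply: (@continuous_comp _ _ _ (fun t => h (2 * pi * t))
    (fun x => x%:C%C : R[i])); last exact: continuous_real_complex.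
  apply: (@continuous_comp _ _ _ (fun t => 2 * pi * t) h); last exact: ch.
  by apply: cvgM; [exact: cvg_cst|exact: cvg_id].
move=> t; apply: cvgD; first exact: cC (@continuous_cos R) t.
by apply: cvgM; [exact: cvg_cst|exact: cC (@continuous_sin R) t].
Qed.

Lemma measurable_circle_map :
  measurable_fun [set: measurableTypeR R] (circle_map : measurableTypeR R -> R[i]).
Proof.
apply: (@measurability _ _ _ _ _ _ (@open R[i])) => //.
move=> _ [U oU <-]; rewrite setTI; apply: open_measurable.
by apply: open_comp => // t _; exact: continuous_circle_map.
Qed.

HB.instance Definition _ :=
  isMeasurableFun.Build _ _ (measurableTypeR R) R[i]
    (circle_map : measurableTypeR R -> R[i]) measurable_circle_map.

(* Normalised Lebesgue measure on the unit circle, as a measure on C. *)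
Definition sigma1 : probability R[i] R :=
  distribution (uniform_prob (@ltr01 R))
    (circle_map : {mfun measurableTypeR R >-> R[i]}).

End circle.

Section torus_measure.
Context (R : realType).

Definition cons_rV n (p : R[i] * 'rV[R[i]]_n) : 'rV[R[i]]_n.+1 :=
  row_mx (p.1)%:M p.2.

Lemma measurable_coord n (k : 'I_n) :
  measurable_fun [set: 'rV[R[i]]_n] (fun z => z 0 k).
Proof.
move=> _ Y mY; rewrite setTI; apply: sub_sigma_algebra => /=.
rewrite -bigcup_seq/=; exists k => /=; first by rewrite mem_index_enum.
by exists Y => //; rewrite setTI.
Qed.

Lemma measurable_cons_rV n : measurable_fun [set: _] (@cons_rV n).
Proof.
apply: (@measurability _ _ _ _ _ _
  (\big[setU/set0]_(k < n.+1) preimage_set_system setT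
    (fun z : 'rV[R[i]]_n.+1 => z 0 k) measurable)) => //.
move=> _ [B + <-]; rewrite -bigcup_seq/= => -[k _ [A mA <-]].
rewrite !setTI -comp_preimage.
suff : measurable_fun setT (fun p => cons_rV p 0 k).
  by move=> /(_ measurableT _ mA); rewrite setTI.
case: (@splitP 1 n k) => j kj.
  rewrite [X in measurable_fun _ X](_ : _ = fst); first exact: measurable_fst.
  apply/funext => p /=; have -> : k = lshift n j by exact/val_inj.
  by apply: etrans (row_mxEl (p.1)%:M p.2 0 j) _; rewrite ord1 mxE.
rewrite [X in measurable_fun _ X](_ : _ = (fun z : 'rV[R[i]]_n => z 0 j) \o snd).
  exact: measurableT_comp (measurable_coord j) measurable_snd.
apply/funext => p /=; have -> : k = rshift 1 j by exact/val_inj.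
exact: row_mxEr (p.1)%:M p.2 0 j.
Qed.

HB.instance Definition _ n :=
  isMeasurableFun.Build _ _ _ _ (@cons_rV n) (@measurable_cons_rV n).

(* The N-fold product of [sigma1], as a measure on C^N. *)
Fixpoint sigma (n : nat) : probability 'rV[R[i]]_n R :=
  match n with
  | 0 => dirac (0 : 'rV[R[i]]_0)
  | n.+1 => distribution (sigma1 R \x sigma n)%E (@cons_rV n)
  end.

End torus_measure.
Arguments sigma {R} n.

Section bloch.
Context (R : realType) (N : nat).
Implicit Types (f g h : 'rV[R[i]]_N -> R[i]) (z : 'rV[R[i]]_N).

Definition polydisc : set 'rV[R[i]]_N := [set z | forall k, normc (z 0 k) < 1].

Definition torus : set 'rV[R[i]]_N := [set z | forall k, normc (z 0 k) = 1].

Definition holomorphic f := forall z, polydisc z -> differentiable f z.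

Definition partial f (k : 'I_N) z : R[i] := 'D_(delta_mx 0 k) f z.

Definition bloch_norm f : \bar R :=
  ((normc (f 0))%:E + ereal_sup
    [set (\sum_(k < N) (1 - normc (z 0 k) ^+ 2) * normc (partial f k z))%:E
      | z in polydisc])%E.

Definition bloch f := holomorphic f /\ (bloch_norm f < +oo)%E.

Definition poly_fun (p : mpoly.mpoly N R[i]) : 'rV[R[i]]_N -> R[i] :=
  fun z => mpoly.meval (fun k => z 0 k) p.

(* Closure of the polynomials in the Bloch space. *)
Definition little_bloch g :=
  bloch g /\ forall delta : R, 0 < delta ->
    exists p, (bloch_norm (poly_fun p \- g)%R < delta%:E)%E.

(* [-oo] when [E] is empty. *)
Definition sup_norm (E : set 'rV[R[i]]_N) h : \bar R :=
  ereal_sup [set (normc (h z))%:E | z in E].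

End bloch.
Arguments polydisc {R} N.
Arguments torus {R} N.

(* Main.v *)
From HB Require Import structures.
Require Import Defs.
From mathcomp Require Import all_boot all_order all_algebra.
From mathcomp Require Import complex.
From mathcomp Require Import all_classical all_reals all_analysis.
From mathcomp Require Import measurable_realfun ring lra.
From mathcomp Require mpoly.
Import (canonicals, coercions) mpoly.
Import Order.TTheory GRing.Theory Num.Theory.
Import numFieldNormedType.Exports.
Import Normc.
Local Open Scope classical_set_scope.
Local Open Scope ring_scope.

(** Approximate [g] by a polynomial [p] in the Bloch norm; it is then enough to
find, for a trigonometric polynomial [Phi] close to a multiple of [phi - p], a
polynomial [h] with [h(0) = 0] and arbitrarily small Bloch seminorm such that
[|Phi - h| <= 2] off a set of small measure ([trig_correction]).

The polynomial [h] is built as a random walk.  Starting from [h = 0], one adds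
corrections [psi(W) Z^M], where [W = Phi - h] is the current gap,
[Z = z_1 ... z_N], [M] is huge and
[psi(w) = d (S^2 - |w|^2) (|w|^2 - 1)].  On the torus [psi(W)] is a
trigonometric polynomial, so [psi(W) Z^M] is there a genuine polynomial as soon
as [M] is large ([trig_lift]).  Rotating [z_1] by an angle of order [1/M] hardly
moves [W] and turns [Z^M] by any prescribed angle: [W] makes a step of length
[|psi(W)|] in a direction which is uniform as far as the averages below can see.
The factor [psi] freezes the walk on the circles of radius [1] and [S] and is so
small that neither can be crossed.  Two averages control the walk
([walk_step]).
- The mean of [|W|^2] grows by the mean of [psi(W)^2] at each step and stays
  below [S^2].  Hence after finitely many steps the mean of [psi(W)^2] is tiny,
  that is, [W] is mostly either of modulus less than [2] or close to [S].
- The mean of [log+ |W|] hardly grows, because [log |w|] is harmonic away from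
  the origin and the walk stays on its side of the unit circle.  If [S] is
  chosen so large that [log S] dominates the initial value, Markov's inequality
  shows that [W] is rarely close to [S].
So [|W| <= 2] on most of the torus.  Only the four rotations by powers of [i]
are used: over them both means are computed by the identities
[sum_rotations] and [prod_rotations].

The Bloch seminorm remains small although there are many corrections, because
their frequencies are widely separated ([bloch_step]): near the boundary the
new term obeys the Schwarz-Pick bound by its supremum while all the old ones
are negligible, and elsewhere the new term is negligible.  Schwarz-Pick, the
maximum principle and the density of trigonometric polynomials are obtained
from finite sums over roots of unity. *)

(** * Modulus and circle map *)

Section modulus.
Context {R : realType}.
Implicit Types (x : R) (z w : R[i]).

Lemma normc_ge0 z : 0 <= normc z.
Proof. by case: z => a b; exact: sqrtr_ge0. Qed.

Lemma normc_gt0 z : (0 < normc z) = (z != 0).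
Proof.
rewrite lt_neqAle normc_ge0 andbT eq_sym; apply/idP/idP; apply: contraNN.
  by move=> /eqP ->; rewrite normc0.
by move=> /eqP/eq0_normc ->.
Qed.

Lemma normc_sqr z : normc z ^+ 2 = complex.Re z ^+ 2 + complex.Im z ^+ 2.
Proof. by case: z => a b; rewrite sqr_sqrtr ?addr_ge0 ?sqr_ge0. Qed.

Lemma normc_sqrC z : (normc z ^+ 2)%:C%C = z * z^*%C.
Proof.
rewrite normc_sqr; case: z => a b /=.
by apply/eqP; rewrite eq_complex /=; apply/andP; split; apply/eqP; ring.
Qed.

Lemma normcC x : normc x%:C%C = `|x|.
Proof. by rewrite /= expr0n /= addr0 sqrtr_sqr. Qed.

Lemma sumrC (I : Type) (s : seq I) (P : pred I) (F : I -> R) :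
  (\sum_(i <- s | P i) F i)%:C%C = \sum_(i <- s | P i) (F i)%:C%C :> R[i].
Proof. exact: (big_morph _ (@rmorphD _ _ (real_complex R)) (rmorph0 _)). Qed.

Lemma normcJ z : normc z^*%C = normc z.
Proof. by case: z => a b /=; rewrite sqrrN. Qed.

Lemma normcX z n : normc (z ^+ n) = normc z ^+ n.
Proof.
by elim: n => [|n IH]; rewrite ?expr0 ?normc1// !exprS normcM IH.
Qed.

Lemma normc_sum (I : Type) (s : seq I) (P : pred I) (F : I -> R[i]) :
  normc (\sum_(i <- s | P i) F i) <= \sum_(i <- s | P i) normc (F i).
Proof.
elim/big_rec2: _ => [|i x z _ IH]; first by rewrite normc0.
by apply: le_trans (le_normcD _ _) _; rewrite lerD2l.
Qed.

Lemma normc_prod (I : Type) (s : seq I) (P : pred I) (F : I -> R[i]) :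
  normc (\prod_(i <- s | P i) F i) = \prod_(i <- s | P i) normc (F i).
Proof.
elim/big_rec2: _ => [|i x z _ IH]; first by rewrite normc1.
by rewrite normcM IH.
Qed.

Lemma normc_nat n : normc (n%:R : R[i]) = n%:R.
Proof.
have -> : (n%:R : R[i]) = (n%:R)%:C%C by rewrite rmorph_nat.
by rewrite normcC ger0_norm.
Qed.

Lemma normcBC z w : normc (z - w) = normc (w - z).
Proof. by rewrite -normcN opprB. Qed.

Lemma normcB z w : normc (z - w) <= normc z + normc w.
Proof. by rewrite -(normcN w); exact: le_normcD. Qed.

Lemma lerB_normc z w : normc z - normc w <= normc (z - w).
Proof. by rewrite lerBlDr -{1}(subrK w z); exact: le_normcD. Qed.

End modulus.

Section circle.
Context {R : realType}.
Implicit Types (s t : R).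
Local Notation e := (@circle_map R).

Lemma circleD s t : e (s + t) = e s * e t.
Proof.
apply/eqP; rewrite eq_complex /= mulrDr cosD sinD.
by apply/andP; split; apply/eqP; ring.
Qed.

Lemma circle0 : e 0 = 1.
Proof. by rewrite /circle_map mulr0 cos0 sin0. Qed.

Lemma circle1 : e 1 = 1.
Proof.
by rewrite /circle_map mulr1 mulr_natl cos2pi sin2pi.
Qed.

Lemma circleMn n t : e (n%:R * t) = e t ^+ n.
Proof.
elim: n => [|n IH]; first by rewrite mul0r circle0.
by rewrite exprS -IH -circleD -natr1 mulrDl mul1r addrC.
Qed.

Lemma circle_quarter : e 4^-1 = 'i%C.
Proof.
have h : 2 * pi * 4^-1 = pi / 2 :> R by field.
by rewrite /circle_map h cos_pihalf sin_pihalf.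
Qed.

Lemma normc_circle t : normc (e t) = 1.
Proof. by rewrite /circle_map /= cos2Dsin2 sqrtr1. Qed.

Lemma circle_neq0 t : e t != 0.
Proof. by rewrite -normc_gt0 normc_circle. Qed.

Lemma circleN t : e (- t) = (e t)^-1.
Proof.
apply: (mulfI (circle_neq0 t)).
by rewrite -circleD subrr circle0 mulfV// circle_neq0.
Qed.

Lemma unitV z : normc z = 1 :> R -> z^-1 = z^*%C.
Proof.
move=> z1; have z0 : z != 0 by rewrite -normc_gt0 z1.
by apply: (mulfI z0); rewrite mulfV// -normc_sqrC z1 expr1n.
Qed.

Lemma circle_eq1 t : `|t| < 1 -> e t = 1 -> t = 0.
Proof.
wlog t0 : t / 0 <= t => [H t1 et|].
  have [/H|/ltW t0] := leP 0 t; first exact.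
  apply/eqP; rewrite -oppr_eq0; apply/eqP; apply: H; rewrite ?oppr_ge0 ?normrN//.
  by rewrite circleN et invr1.
rewrite (ger0_norm t0) => t1 [ct st].
have ppi := @pi_gt0 R.
have [t2|t2] := leP t 2^-1.
  have : 2 * pi * t = 0 :> R.
    apply: cos_inj; rewrite ?in_itv/= ?lexx ?pi_ge0//; last by rewrite ct cos0.
    rewrite !mulr_ge0 ?pi_ge0//=.
    have -> : 2 * pi * t = pi * (2 * t) by ring.
    by rewrite ger_pMr//; lra.
  by move=> /eqP; rewrite !mulf_eq0 gt_eqF//= gt_eqF//= => /eqP.
have : 2 * pi * (1 - t) = 0 :> R.
  apply: cos_inj; rewrite ?in_itv/= ?lexx ?pi_ge0//.
    rewrite !mulr_ge0 ?pi_ge0//=; last by lra.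
    have -> : 2 * pi * (1 - t) = pi * (2 * (1 - t)) by ring.
    by rewrite ger_pMr//; lra.
  rewrite mulrBr mulr1 cosB ct st mulr0 addr0 mulr1 cos0.
  by rewrite mulr_natl cos2pi.
move=> /eqP; rewrite !mulf_eq0 gt_eqF//= gt_eqF//= => /eqP; lra.
Qed.

Lemma circle_surj (z : R[i]) : normc z = 1 -> exists2 t, t \in `[0, 1] & e t = z.
Proof.
have ppi := @pi_gt0 R.
move=> z1; have := normc_sqr z; rewrite z1 expr1n; case: z {z1} => a b /= ab.
have a1 : -1 <= a <= 1.
  by rewrite -ler_norml -(@ler_pXn2r _ 2)// ?nnegrE// expr1n
    real_normK ?num_real// ab lerDl sqr_ge0.
have sa : sin (acos a) = `|b|.
  by rewrite sin_acos// -sqrtr_sqr; congr Num.sqrt; rewrite ab; ring.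
have p2 : (2 * pi : R) != 0 by rewrite mulf_neq0// gt_eqF.
have u0 : 0 <= acos a / (2 * pi) by rewrite divr_ge0 ?mulr_ge0 ?pi_ge0// acos_ge0.
have u1 : acos a / (2 * pi) <= 1.
  by rewrite ler_pdivrMr ?mulr_gt0// mul1r (le_trans (acos_lepi a1))// ler_peMl ?pi_ge0// ler1n.
have [b0|b0] := leP 0 b.
  exists (acos a / (2 * pi)); first by rewrite in_itv/= u0.
  by rewrite /circle_map mulrC divfK// acosK// sa ger0_norm.
exists (1 - acos a / (2 * pi)); first by rewrite in_itv/=; lra.
rewrite circleD circle1 mul1r circleN /circle_map [2 * pi * _]mulrC divfK//.
rewrite acosK// sa ltr0_norm// unitV; first by rewrite /= opprK.
by rewrite /= sqrrN -ab sqrtr1.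
Qed.

End circle.

(** * Schwarz-Pick for polynomials, by sums over roots of unity *)

Section roots_of_unity.
Context {R : realType}.
Implicit Types (z : R[i]) (L M : nat).

Definition unity_root M : R[i] := circle_map M%:R^-1.
Local Notation om M j := (unity_root M ^+ j).

Lemma unity_rootX M : (0 < M)%N -> om M M = 1.
Proof.
by move=> M0; rewrite -circleMn divff ?circle1// pnatr_eq0 -lt0n.
Qed.

Lemma normc_unity M j : normc (om M j) = 1.
Proof. by rewrite normcX normc_circle expr1n. Qed.

Lemma sum_unity M d c : (d < M)%N -> (c < M)%N ->
  \sum_(j < M) om M j ^+ d * (om M j)^-1 ^+ c = (if d == c then M%:R else 0).
Proof.
move=> dM cM; have M0 : (0 < M)%N by exact: leq_ltn_trans dM.
have M0' : (M%:R : R) != 0 by rewrite pnatr_eq0 -lt0n.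
pose u : R[i] := unity_root M ^+ d * (unity_root M)^-1 ^+ c.
have -> : \sum_(j < M) om M j ^+ d * (om M j)^-1 ^+ c = \sum_(j < M) u ^+ j.
  apply: eq_bigr => j _.
  by rewrite /u exprMn -exprVn -!exprM ![(j * _)%N]mulnC.
have uE : u = circle_map ((d%:R - c%:R) * M%:R^-1).
  by rewrite mulrBl circleD circleN !circleMn /u exprVn.
case: eqP => [dc|/eqP dc].
  under eq_bigr do rewrite uE dc subrr mul0r circle0 expr1n.
  by rewrite sumr_const card_ord.
have u1 : u - 1 != 0.
  rewrite subr_eq0; apply: contra dc => /eqP; rewrite uE => /circle_eq1 H.
  have /eqP : (d%:R - c%:R) / M%:R = 0 :> R.
    apply: H; rewrite normrM normfV (ger0_norm (ler0n _ _)).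
    rewrite ltr_pdivrMr ?ltr0n// mul1r ltr_norml.
    have : (d%:R : R) < M%:R by rewrite ltr_nat.
    have : (c%:R : R) < M%:R by rewrite ltr_nat.
    have := ler0n R d; have := ler0n R c; lra.
  by rewrite mulf_eq0 invr_eq0 (negPf M0') orbF subr_eq0 eqr_nat.
apply: (mulfI u1); rewrite mulr0 -subrX1 /u exprMn -!exprM ![(_ * M)%N]mulnC.
by rewrite !exprM exprVn unity_rootX// invr1 !expr1n mulr1 subrr.
Qed.

(** Parseval for the discrete Fourier transform.  With more nodes than the
degrees involved there is no aliasing, so that Cauchy's integral formulas become
exact finite identities. *)
Lemma unity_parseval (p q : {poly _}) M :
  (size p <= M)%N -> (size q <= M)%N ->
  \sum_(j < M) p.[om M j] * q.[(om M j)^-1] = M%:R * \sum_(d < M) p`_d * q`_d.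
Proof.
move=> pM qM.
transitivity (\sum_(j < M) \sum_(d < M) \sum_(c < M)
   p`_d * q`_c * (om M j ^+ d * (om M j)^-1 ^+ c)).
  apply: eq_bigr => j _; rewrite (horner_coef_wide _ pM) (horner_coef_wide _ qM).
  rewrite mulr_suml; apply: eq_bigr => d _; rewrite mulr_sumr.
  by apply: eq_bigr => c _; ring.
rewrite exchange_big /= mulr_sumr; apply: eq_bigr => d _.
rewrite exchange_big /= (bigD1 d)//= -mulr_sumr sum_unity// eqxx.
rewrite big1 ?addr0 => [|c cd]; first by rewrite mulrC.
rewrite -mulr_sumr sum_unity// ifF ?mulr0//.
by apply/negbTE; rewrite eq_sym; exact: cd.
Qed.

End roots_of_unity.

Section geometric.
Context {R : realType}.

Lemma geometric_sum_le (x : R) L : 0 <= x -> x < 1 ->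
  (\sum_(a < L) x ^+ a) * (1 - x) <= 1.
Proof.
move=> x0 x1.
have -> : (\sum_(a < L) x ^+ a) * (1 - x) = 1 - x ^+ L.
  by rewrite mulrC -(opprB x 1) mulNr -subrX1 opprB.
by rewrite lerBlDr lerDl exprn_ge0.
Qed.

Lemma bernoulli (y : R) n : 0 <= y -> 1 + n%:R * y <= (1 + y) ^+ n.
Proof.
move=> y0; elim: n => [|n IH]; first by rewrite mul0r addr0.
rewrite exprS; apply: le_trans (ler_wpM2l _ IH); last by rewrite addr_ge0.
have := ler0n R n => n0; rewrite -natr1.
have : 0 <= n%:R * y * y by rewrite !mulr_ge0.
by lra.
Qed.

(** The power trick: a bound with a constant, valid for all powers, holds
without the constant. *)
Lemma expr_bounded_le (x A c : R) : 0 <= x -> 0 <= A ->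
  (forall k, x ^+ k <= A ^+ k * c) -> x <= A.
Proof.
move=> x0 A0 H; rewrite leNgt; apply/negP => Ax.
have {A0} := A0; rewrite le_eqVlt => /predU1P[A0|A0].
  by move: Ax; rewrite ltNge; have := H 1%N; rewrite -A0 !expr1 mul0r => ->.
pose y := x / A - 1.
have y0 : 0 < y by rewrite subr_gt0 ltr_pdivlMr// mul1r.
have B k : 1 + k%:R * y <= c.
  apply: le_trans (bernoulli _ _ (ltW y0)) _.
  by rewrite /y subrKC expr_div_n ler_pdivrMr ?exprn_gt0// mulrC.
have c0 : 0 <= c by apply: le_trans (B 0%N); rewrite mul0r addr0.
have := B (Num.Def.archi_bound (c / y)); apply/negP; rewrite -ltNge.
have := archi_boundP (divr_ge0 c0 (ltW y0)); rewrite ltr_pdivrMr//; lra.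
Qed.

End geometric.

Section univariate.
Context {R : realType}.
Implicit Types (z : R[i]) (A r : R).
Local Notation om M j := (unity_root M ^+ j).

(** The Cauchy kernel [1 / (1 - z x)], truncated at degree [L]. *)
Let ker L z := \poly_(a < L) z ^+ a.

Lemma conj_ker L z t : normc t = 1 ->
  ((ker L z).[t^-1])^*%C = (ker L z^*%C).[t].
Proof.
move=> t1; rewrite !horner_poly rmorph_sum; apply: eq_bigr => a _.
by rewrite rmorphM !rmorphXn /= unitV// conjcK.
Qed.

Lemma ker_l2 L M z : (0 < M)%N -> (L <= M)%N ->
  \sum_(j < M) normc ((ker L z).[(om M j)^-1]) ^+ 2 =
  M%:R * \sum_(a < L) (normc z ^+ 2) ^+ a.
Proof.
move=> M0 LM; apply: complexI.
rewrite [RHS]rmorphM /= [in RHS]rmorph_nat !sumrC.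
transitivity (\sum_(j < M) (ker L z^*%C).[om M j] * (ker L z).[(om M j)^-1]).
  apply eq_bigr => j _.
  by rewrite normc_sqrC -conj_ker ?normc_unity// mulrC.
rewrite unity_parseval ?(leq_trans (size_poly _ _))//.
congr (_ * _); rewrite (big_ord_widen M (fun a => (((normc z ^+ 2) ^+ a)%:C)%C))//.
rewrite [RHS]big_mkcond/=; apply eq_bigr => a _; rewrite !coef_poly.
case: ifP => aL; last by rewrite mulr0.
by rewrite rmorphXn /= normc_sqrC exprMn mulrC.
Qed.

(** Cauchy's formula gives the maximum principle up to a factor, which is
removed afterwards by applying it to powers of the polynomial. *)
Lemma horner_disc_le_crude (p : {poly _}) A z : (forall t, normc t = 1 -> normc p.[t] <= A) ->
  normc z < 1 -> normc p.[z] * (1 - normc z) <= A.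
Proof.
move=> pA z1; pose M := (size p).+1.
have A0 : 0 <= A by apply: le_trans (pA 1 (normc1 _)); exact: normc_ge0.
have E : M%:R * p.[z] = \sum_(j < M) p.[om M j] * (ker M z).[(om M j)^-1].
  rewrite unity_parseval ?size_poly// (@horner_coef_wide _ M p)//.
  by congr (_ * _); apply: eq_bigr => d _; rewrite coef_poly ltn_ord.
have M0 : 0 < M%:R :> R by rewrite ltr0n.
have : normc (M%:R * p.[z]) <= \sum_(j < M) A * \sum_(a < M) normc z ^+ a.
  rewrite E; apply: le_trans (normc_sum _ _ _ _) _; apply: ler_sum => j _.
  rewrite normcM ler_pM ?normc_ge0 ?pA ?normc_unity//.
  rewrite horner_poly; apply: le_trans (normc_sum _ _ _ _) _.
  by apply: ler_sum => a _; rewrite normcM !normcX normcV normc_unity invr1 expr1n mulr1.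
rewrite normcM normc_nat sumr_const card_ord -[leRHS]mulr_natl ler_pM2l// => H.
rewrite -subr_gt0 in z1; apply: le_trans (ler_wpM2r (ltW z1) H) _.
rewrite -mulrA ler_piMr// geometric_sum_le ?normc_ge0//; rewrite -subr_gt0//.
Qed.

Lemma horner_disc_le (p : {poly _}) A z : (forall t, normc t = 1 -> normc p.[t] <= A) ->
  normc z <= 1 -> normc p.[z] <= A.
Proof.
move=> pA; rewrite le_eqVlt => /predU1P[/pA//|z1].
have A0 : 0 <= A by apply: le_trans (pA 1 (normc1 _)); exact: normc_ge0.
apply: (@expr_bounded_le _ _ _ (1 - normc z)^-1); rewrite ?normc_ge0// => k.
rewrite ler_pdivlMr ?subr_gt0// -normcX -horner_exp.
apply: horner_disc_le_crude => // t t1.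
by rewrite horner_exp normcX lerXn2r ?nnegrE ?normc_ge0// pA.
Qed.

(** The derivative is reproduced by the kernel [x / (1 - z x)^2], whose modulus
on the circle is the square of that of the Cauchy kernel; its mean is therefore
at most [1 / (1 - |z|^2)]. *)
Lemma schwarz_pick1 (p : {poly _}) A z : (forall t, normc t = 1 -> normc p.[t] <= A) ->
  normc z < 1 -> normc (p^`()).[z] * (1 - normc z ^+ 2) <= A.
Proof.
move=> pA z1; pose L := (size p).+1; pose M := (L + L)%N.
have A0 : 0 <= A by apply: le_trans (pA 1 (normc1 _)); exact: normc_ge0.
pose F := ker L z * ker L z * 'X.
have sF : (size F <= M)%N.
  have k : (size (ker L z) <= L)%N by exact: size_poly.
  have k2 : (size (ker L z * ker L z)%R <= (L + L).-1)%N.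
    by rewrite (leq_trans (size_polyMleq _ _))// -!subn1 leq_sub2r// leq_add.
  rewrite (leq_trans (size_polyMleq _ _))// size_polyX addn2/=.
  exact: leq_ltn_trans k2 _.
have E : M%:R * (p^`()).[z] = \sum_(j < M) p.[om M j] * F.[(om M j)^-1].
  rewrite unity_parseval//; last by rewrite /M addnS leqW// /L addSn leqW// leq_addr.
  rewrite big_ord_recl coefMX eqxx mulr0 add0r; congr (_ * _).
  rewrite (@horner_coef_wide _ (size p + L)); last first.
    by rewrite (leq_trans (size_poly _ _))// (leq_trans (leq_pred _))// leq_addr.
  apply: eq_bigr => d _; rewrite coef_deriv coefMX lift0 /=.
  have [dp|dp] := ltnP d (size p); last by rewrite nth_default ?(leqW dp)// mul0rn !mul0r.
  rewrite -mulr_natr -mulrA; congr (_ * _); rewrite coefM.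
  rewrite (eq_bigr (fun=> z ^+ d)) ?sumr_const ?card_ord ?mulr_natl// => i _.
  have il : (i <= d)%N by rewrite -ltnS.
  have dL : (d < L)%N by rewrite ltnS ltnW.
  rewrite !coef_poly (leq_ltn_trans il dL) (leq_ltn_trans (leq_subr _ _) dL).
  by rewrite -exprD subnKC.
have M0 : 0 < M%:R :> R by rewrite ltr0n.
have : normc (M%:R * (p^`()).[z]) <= A * (M%:R * \sum_(a < L) (normc z ^+ 2) ^+ a).
  rewrite E -(@ker_l2 _ M)// ?leq_addr// mulr_sumr.
  apply: le_trans (normc_sum _ _ _ _) _; apply: ler_sum => j _.
  rewrite normcM ler_pM ?normc_ge0 ?pA ?normc_unity//.
  by rewrite /F !hornerM hornerX !normcM normcV normc_unity invr1 mulr1.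
rewrite normcM normc_nat mulrCA ler_pM2l// => H.
have z2 : normc z ^+ 2 < 1 by rewrite expr_lt1// normc_ge0.
rewrite -subr_gt0 in z2; apply: le_trans (ler_wpM2r (ltW z2) H) _.
by rewrite -mulrA ler_piMr// geometric_sum_le ?sqr_ge0// -subr_gt0.
Qed.

Lemma schwarz_pick (p : {poly _}) A r z : 0 < r ->
  (forall t, normc t = r -> normc p.[t] <= A) -> normc z < r ->
  normc (p^`()).[z] * (r ^+ 2 - normc z ^+ 2) <= A * r.
Proof.
move=> r0 pA zr; pose rc : R[i] := r%:C%C.
have nrc : normc rc = r by rewrite normcC gtr0_norm.
have rc0 : rc != 0 by rewrite -normc_gt0 nrc.
have H : normc ((p \Po (rc *: 'X))^`()).[z / rc] * (1 - normc (z / rc) ^+ 2) <= A.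
  apply: schwarz_pick1.
    by move=> t t1; rewrite horner_comp !hornerE pA// normcM nrc t1 mulr1.
  by rewrite normcM normcV nrc ltr_pdivrMr// mul1r.
have z2 : rc * z / rc = z by rewrite mulrAC divff ?mul1r.
move: H; rewrite deriv_comp hornerM horner_comp !hornerE /=.
rewrite z2.
rewrite derivZ derivX !hornerE /= ?mulr1 ![normc (_ * _)]normcM normcV nrc.
have r2 : 0 < r ^+ 2 by rewrite exprn_gt0.
move=> /(ler_wpM2r (ltW r0)); apply: le_trans; rewrite le_eqVlt; apply/orP; left; apply/eqP.
by field; rewrite gt_eqF.
Qed.

End univariate.

(** * The Bloch seminorm of a sum with a high frequency term *)

Lemma expr_small {R : realType} (r x : R) : 0 <= r -> r < 1 -> 0 < x ->
  exists l0, forall l, (l0 <= l)%N -> r ^+ l <= x.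
Proof.
move=> r0 r1 x0; have := @cvg_expr R r; rewrite ger0_norm// => /(_ r1).
move=> /cvgr0Pnorm_le /(_ x x0) [l0 _ H]; exists l0 => l /H.
by rewrite ger0_norm// exprn_ge0.
Qed.

Section slices.
Context {R : realType} {N : nat}.
Implicit Types (z : 'rV[R[i]]_N) (k : 'I_N) (q h : mpoly.mpoly N R[i]).

Definition set_coord z k (t : R[i]) : 'rV[R[i]]_N :=
  \row_j (if j == k then t else z 0 j).

Lemma set_coord_id z k : set_coord z k (z 0 k) = z.
Proof. by apply/rowP => j; rewrite mxE; case: eqP => // ->. Qed.

Lemma poly_fun_slice q k z :
  exists p : {poly _}, forall t, poly_fun q (set_coord z k t) = p.[t].
Proof.
exists (\sum_(m <- mpoly.msupp q) (mpoly.mcoeff m q)%:P *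
  \prod_i (if i == k then 'X else (z 0 i)%:P) ^+ mpoly.fun_of_multinom m i) => t.
rewrite /poly_fun mpoly.mevalE horner_sum; apply: eq_bigr => m _.
rewrite hornerM hornerC horner_prod; congr (_ * _); apply: eq_bigr => i _.
by rewrite mxE horner_exp; case: eqP => _; rewrite ?hornerX ?hornerC.
Qed.

Lemma horner_is_derive (p : {poly _}) (x : R[i]) :
  is_derive x (1 : R[i]) (fun t : R[i] => p.[t] : R[i]) p^`().[x].
Proof.
elim/poly_ind: p => [|p r IH].
  rewrite deriv0 horner0 (_ : (fun t => _) = cst 0); last by apply/funext => t; rewrite horner0.
  exact: is_derive_cst.
rewrite (_ : (fun t => _) = (fun t => p.[t]) * id + cst r); last first.
  by apply/funext => t; rewrite !fctE !hornerE.
apply: is_derive_eq.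
rewrite derivMXaddC hornerD hornerMX addr0 /=.
by congr (_ + _); [exact: mulr1|exact: mulrC].
Qed.

(** Partial derivatives of polynomials are computed on one-variable slices. *)
Lemma partialE (f : 'rV[R[i]]_N -> R[i]) k z (p : {poly _}) :
  (forall t, f (set_coord z k t) = p.[t]) ->
  derivable f z (delta_mx 0 k) /\ partial f k z = p^`().[z 0 k].
Proof.
move=> fp; have [D E] := horner_is_derive p (z 0 k).
have H : (fun h : R[i] => h^-1 *: ((f \o shift z) (h *: delta_mx 0 k) - f z)) =
  (fun h : R[i] => h^-1 *: (((fun t : R[i] => p.[t]) \o shift (z 0 k))
    (h *: (1 : R[i])) - p.[z 0 k])).
  apply/funext => h; congr (_ *: (_ - _)); rewrite /= -fp ?set_coord_id//.
  congr f; apply/rowP => j; rewrite !mxE /= ?eqxx /=.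
  by case: eqP => [->|_]; rewrite ?mulr0 ?add0r.
by split; [rewrite /derivable H|rewrite /partial /derive H].
Qed.

Lemma poly_fun_derivable q k z : derivable (poly_fun q) z (delta_mx 0 k).
Proof. by have [p /partialE[]] := poly_fun_slice q k z. Qed.

(** The coordinates are moved one at a time from the disc to the circle. *)
Lemma maximum_principle q A :
  (forall z, torus N z -> normc (poly_fun q z) <= A) ->
  forall z, (forall k, normc (z 0 k) <= 1) -> normc (poly_fun q z) <= A.
Proof.
move=> qA z z1.
suff H (s : seq 'I_N) : forall z, (forall k, normc (z 0 k) <= 1) ->
    (forall k, k \notin s -> normc (z 0 k) = 1) -> normc (poly_fun q z) <= A.
  by apply: (H (enum 'I_N)) => // k; rewrite mem_enum.
elim: s => [|k s IH] {}z {}z1 zs; first by apply: qA => k; exact: zs.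
have [p pE] := poly_fun_slice q k z.
rewrite -(set_coord_id z k) pE; apply: horner_disc_le (z1 k) => t t1.
rewrite -pE; apply: IH => j; rewrite mxE; case: eqP => [_|/eqP jk] //.
- by rewrite t1.
- by move=> js; apply: zs; rewrite inE negb_or jk.
Qed.

Lemma poly_fun_bounded q (r : R) : 0 <= r ->
  exists2 H : R, 0 <= H & forall z, (forall k, normc (z 0 k) <= r) -> normc (poly_fun q z) <= H.
Proof.
move=> r0; exists (\sum_(m <- mpoly.msupp q) normc (mpoly.mcoeff m q) *
  \prod_i r ^+ mpoly.fun_of_multinom m i).
  apply: sumr_ge0 => m _; rewrite mulr_ge0 ?normc_ge0// prodr_ge0// => i _.
  exact: exprn_ge0.
move=> z zr; rewrite /poly_fun mpoly.mevalE.
apply: le_trans (normc_sum _ _ _ _) _; apply: ler_sum => m _.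
rewrite normcM ler_wpM2l ?normc_ge0// normc_prod ler_prod// => i _.
by rewrite normc_ge0 /= normcX lerXn2r ?nnegrE ?normc_ge0.
Qed.

End slices.

Section bloch_step.
Context {R : realType} {N : nat}.
Implicit Types (z : 'rV[R[i]]_N) (k : 'I_N) (q h : mpoly.mpoly N R[i]).

Definition bloch_coef (f : 'rV[R[i]]_N -> R[i]) k z : R :=
  (1 - normc (z 0 k) ^+ 2) * normc (partial f k z).

Lemma partialD (f g : 'rV[R[i]]_N -> R[i]) k z :
  derivable f z (delta_mx 0 k) -> derivable g z (delta_mx 0 k) ->
  partial (f \+ g) k z = partial f k z + partial g k z.
Proof. by move=> df dg; rewrite /partial deriveD. Qed.

Lemma bloch_coefD (f g : 'rV[R[i]]_N -> R[i]) k z : polydisc N z ->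
  derivable f z (delta_mx 0 k) -> derivable g z (delta_mx 0 k) ->
  bloch_coef (f \+ g) k z <= bloch_coef f k z + bloch_coef g k z.
Proof.
move=> z1 df dg; rewrite /bloch_coef partialD// -mulrDr ler_wpM2l ?le_normcD//.
by rewrite subr_ge0 expr_le1 ?normc_ge0// ltW.
Qed.

Definition coord_prod : mpoly.mpoly N R[i] := \prod_i mpoly.mpolyX _ (mpoly.mnm1 i).

Lemma coord_prodE z : poly_fun coord_prod z = \prod_i z 0 i.
Proof.
rewrite /poly_fun rmorph_prod; apply: eq_bigr => i _; exact: mpoly.mevalXU.
Qed.

Lemma poly_funM q h z : poly_fun (q * h) z = poly_fun q z * poly_fun h z.
Proof. exact: mpoly.mevalM. Qed.

Lemma poly_funX q n z : poly_fun (q ^+ n) z = poly_fun q z ^+ n.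
Proof. by rewrite /poly_fun rmorphXn. Qed.

Lemma poly_funD q h : poly_fun (q + h) = poly_fun q \+ poly_fun h.
Proof. by apply/funext => z; exact: mpoly.mevalD. Qed.

Lemma normc_coord_prod z k : (forall j, normc (z 0 j) <= 1) ->
  normc (\prod_i z 0 i) <= normc (z 0 k).
Proof.
move=> z1; rewrite normc_prod (bigD1 k)//= ler_piMr ?normc_ge0//.
by apply: prodr_ile1 => i _; rewrite normc_ge0 z1.
Qed.

Lemma schwarz_pick_polydisc q k z (A r : R) : polydisc N z -> 0 < r -> r <= 1 ->
  normc (z 0 k) < r ->
  (forall w : 'rV[R[i]]_N, (forall j, normc (w 0 j) <= 1) -> normc (w 0 k) = r ->
     normc (poly_fun q w) <= A) ->
  normc (partial (poly_fun q) k z) * (r ^+ 2 - normc (z 0 k) ^+ 2) <= A * r.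
Proof.
move=> z1 r0 r1 zr qA; have [p pE] := poly_fun_slice q k z.
have [_ ->] := partialE _ _ _ _ pE; apply: schwarz_pick => // t tr.
rewrite -pE; apply: qA => [j|]; rewrite mxE ?eqxx//.
by case: eqP; rewrite ?tr// => _; rewrite ltW.
Qed.

(** Schwarz-Pick on the polydisc of radius [2]. *)
Lemma partial_bounded q : exists2 H : R, 0 < H &
  forall k z, polydisc N z -> normc (partial (poly_fun q) k z) <= H.
Proof.
have [H H0 qH] := @poly_fun_bounded R N q 2 ltac:(by []).
exists (H + 1); first by rewrite ltr_pwDr.
move=> k z z1; have [p pE] := poly_fun_slice q k z.
have [_ ->] := partialE _ _ _ _ pE.
have z12 : normc (z 0 k) < 2 by apply: lt_trans (z1 k) _; rewrite ltr1n.
have := @schwarz_pick R p H 2 (z 0 k) ltac:(by []) _ z12.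
have -> : (2 ^+ 2 : R) = 4 by ring.
set x := normc p^`().[_]; set y := normc _ ^+ 2.
have y1 : y <= 1 by rewrite /y expr_le1 ?normc_ge0// ltW.
have x0 : 0 <= x by exact: normc_ge0.
move=> K; suff : x * 3 <= H * 2 by lra.
apply: le_trans (K _); first by rewrite ler_wpM2l//; lra.
move=> t t2; rewrite -pE; apply: qH => j; rewrite mxE; case: eqP => _; first by rewrite t2.
by apply: le_trans (ltW (z1 j)) _; rewrite ler1n.
Qed.

(** Frequency separation.  Where [1 - |z_k|^2] is small the derivative of [h],
which is bounded, contributes at most [eta], and the new term at most [A] by
Schwarz-Pick.  Elsewhere [|z_k|] is bounded away from [1], and the new term
carries the factor [|z_k|^l], so it contributes at most [eta] for large [l].
The bound thus increases by [eta] only, and not by [A]. *)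
Lemma bloch_step h q (A B eta : R) : A <= B -> 0 < eta ->
  (forall z, torus N z -> normc (poly_fun q z) <= A) ->
  (forall k z, polydisc N z -> bloch_coef (poly_fun h) k z <= B) ->
  exists l0, forall l, (l0 <= l)%N -> forall k z, polydisc N z ->
    bloch_coef (poly_fun (h + q * coord_prod ^+ l)) k z <= B + eta.
Proof.
move=> AB eta0 qA hB.
have qA' := maximum_principle _ _ qA.
have [H H0 hH] := partial_bounded h.
have PA l k (w : 'rV[R[i]]_N) : (forall j, normc (w 0 j) <= 1) ->
    normc (poly_fun (q * coord_prod ^+ l) w) <= A * normc (w 0 k) ^+ l.
  move=> w1; rewrite poly_funM poly_funX coord_prodE normcM normcX.
  rewrite ler_pM ?qA' ?exprn_ge0 ?normc_ge0// lerXn2r ?nnegrE ?normc_ge0//.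
  exact: normc_coord_prod.
(* The two regimes meet where [1 - |z_k|^2 = c]; the circle of radius [r] lies
halfway, which leaves room for Schwarz-Pick in the inner regime. *)
pose c := eta / H.
have c0 : 0 < c by rewrite divr_gt0.
pose r := Num.sqrt (Num.max 0 (1 - c / 2)).
have r0 : 0 <= r by exact: sqrtr_ge0.
have r2 : r ^+ 2 = Num.max 0 (1 - c / 2) by rewrite sqr_sqrtr// le_max lexx.
have r1 : r < 1.
  rewrite -(@ltr_pXn2r _ 2)// ?nnegrE// r2 expr1n gt_max ltr01 /=; lra.
(* [A] may vanish, and a positive denominator is needed. *)
pose A1 := `|A| + 1.
have A10 : 0 < A1 by rewrite ltr_pwDr.
have [l0 Hl0] := @expr_small R r (eta * (c / 2) / A1) r0 r1 ltac:(by rewrite !mulr_gt0 ?invr_gt0).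
exists l0 => l ll0 k z z1.
rewrite poly_funD; apply: le_trans (bloch_coefD _ _ _ _ z1 _ _) _;
  try exact: poly_fun_derivable.
set x := normc (z 0 k); have x0 : 0 <= x by exact: normc_ge0.
have x1 : x < 1 by exact: z1.
have xx1 : x ^+ 2 <= 1 by rewrite expr_le1// ltW.
have [small|big] := leP ((1 - x ^+ 2) * H) eta.
  rewrite addrC; apply: lerD; last first.
    apply: le_trans small; rewrite /bloch_coef -/x ler_wpM2l ?subr_ge0//.
    exact: hH.
  apply: le_trans AB.
  have := @schwarz_pick_polydisc (q * coord_prod ^+ l) k z A 1 z1 ltr01 (lexx _) x1.
  rewrite expr1n mulr1 /bloch_coef -/x [(1 - _) * _]mulrC.
  apply => w w1 wk.
  by apply: le_trans (PA l k w w1) _; rewrite wk expr1n mulr1.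
apply: lerD; first exact: hB.
have xc : x ^+ 2 < 1 - c by move: big; rewrite -ltr_pdivrMr// -/c; lra.
have rE : r ^+ 2 = 1 - c / 2.
  rewrite r2; apply/max_idPr; have := sqr_ge0 x; lra.
have rx : x < r by rewrite -(@ltr_pXn2r _ 2)// ?nnegrE// rE; lra.
have r0' : 0 < r by exact: le_lt_trans x0 rx.
have := @schwarz_pick_polydisc (q * coord_prod ^+ l) k z (A * r ^+ l) r z1 r0' (ltW r1) rx.
rewrite /bloch_coef -/x; set y := normc (partial _ _ _) => K.
have y0 : 0 <= y by exact: normc_ge0.
have {K} : y * (r ^+ 2 - x ^+ 2) <= A * r ^+ l * r.
  by apply: K => w w1 wk; rewrite -wk; apply: PA.
have rl : 0 <= r ^+ l by exact: exprn_ge0.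
have A1r : A * r ^+ l * r <= A1 * r ^+ l.
  have AA : A <= A1 by rewrite (le_trans (ler_norm _))// lerDl.
  apply: (@le_trans _ _ (A1 * r ^+ l * r)); first by rewrite ler_wpM2r// ler_wpM2r.
  by rewrite ler_piMr ?mulr_ge0// ltW.
have := Hl0 l ll0; rewrite ler_pdivlMr// => L1 L2.
have L3 : y * (c / 2) <= eta * (c / 2).
  apply: (@le_trans _ _ (y * (r ^+ 2 - x ^+ 2))).
    by rewrite ler_wpM2l// rE; lra.
  apply: le_trans L2 _; apply: le_trans A1r _; by rewrite mulrC.
have {L3} : y <= eta by rewrite -(@ler_pM2r _ (c / 2))// divr_gt0.
have := mulr_ge0 (sqr_ge0 x) y0; lra.
Qed.

End bloch_step.

(** * Trigonometric polynomials *)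

Section complex_topology.
Context {R : realType}.

Lemma normCE (z : R[i]) : `|z| = (normc z)%:C%C.
Proof. by rewrite normc_def; case: z. Qed.

Lemma circle_near1 (tau : R) : 0 < tau ->
  exists2 d : R, 0 < d & forall t, `|t| < d -> normc (circle_map t - 1) <= tau.
Proof.
move=> tau0; have := @continuous_circle_map R 0. rewrite /continuous_at circle0.
move=> /cvgrPdist_le /(_ tau%:C%C); rewrite ltcR => /(_ tau0).
rewrite -nbhs_ballE => -[d /= d0 H]; exists d => // t td.
have := H t; rewrite /ball /= sub0r normrN => /(_ td).
by rewrite normCE lecR normcBC.
Qed.

Lemma continuous_Re : continuous (@complex.Re R).
Proof.
move=> z; apply/(@cvgrPdist_le _ _ _ (nbhs z) (nbhs_filter z)) => e e0; apply/nbhs_ballP.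
exists e%:C%C; first by rewrite /= ltcR.
move=> w; rewrite /ball /= normCE ltcR => /ltW; apply: le_trans.
rewrite -(@ler_pXn2r _ 2)// ?nnegrE ?normc_ge0// normc_sqr real_normK ?num_real//.
by rewrite [complex.Re (_ - _)]raddfB lerDl sqr_ge0.
Qed.

Lemma continuous_Im : continuous (@complex.Im R).
Proof.
move=> z; apply/(@cvgrPdist_le _ _ _ (nbhs z) (nbhs_filter z)) => e e0; apply/nbhs_ballP.
exists e%:C%C; first by rewrite /= ltcR.
move=> w; rewrite /ball /= normCE ltcR => /ltW; apply: le_trans.
rewrite -(@ler_pXn2r _ 2)// ?nnegrE ?normc_ge0// normc_sqr real_normK ?num_real//.
by rewrite [complex.Im (_ - _)]raddfB lerDr sqr_ge0.
Qed.

Lemma continuous_measurable_real (f : R[i] -> R) : continuous f ->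
  measurable_fun [set: R[i]] f.
Proof.
move=> cf; apply: (measurability _ (RGenOpens.measurableE R)).
move=> _ [U [a [b ->]] <-]; rewrite setTI.
by apply: sub_sigma_algebra; apply: open_comp => // z _; exact: cf.
Qed.

End complex_topology.

Section trig.
Context {R : realType} {N : nat}.
Local Notation point := 'rV[R[i]]_N.

(** Polynomials in the coordinates and their conjugates: their restrictions to
the torus are the trigonometric polynomials.  Conjugating only the coordinates
gives a convenient induction; [trigJ] recovers closure under conjugation. *)
Inductive trig : (point -> R[i]) -> Prop :=
| trig_cst c : trig (fun=> c)
| trig_coord k : trig (fun z => z 0 k)
| trig_coordJ k : trig (fun z => (z 0 k)^*%C)
| trigD f g : trig f -> trig g -> trig (fun z => f z + g z)
| trigM f g : trig f -> trig g -> trig (fun z => f z * g z).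

Lemma trigJ f : trig f -> trig (fun z => (f z)^*%C).
Proof.
elim=> [c|k|k|{}f g _ Hf _ Hg|{}f g _ Hf _ Hg].
- exact: trig_cst.
- exact: trig_coordJ.
- under eq_fun do rewrite conjcK; exact: trig_coord.
- under eq_fun do rewrite rmorphD; exact: trigD.
- under eq_fun do rewrite rmorphM; exact: trigM.
Qed.

Lemma trigN f : trig f -> trig (fun z => - f z).
Proof.
move=> Hf; under eq_fun do rewrite -mulN1r.
exact: trigM (trig_cst _) Hf.
Qed.

Lemma trigX f n : trig f -> trig (fun z => f z ^+ n).
Proof.
move=> Hf; elim: n => [|n IH]; first exact: trig_cst.
by under eq_fun do rewrite exprS; exact: trigM.
Qed.

Lemma trig_sum (I : Type) (s : seq I) (F : I -> point -> R[i]) :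
  (forall i, trig (F i)) -> trig (fun z => \sum_(i <- s) F i z).
Proof.
move=> HF; elim: s => [|i s IH].
  by under eq_fun do rewrite big_nil; exact: trig_cst.
by under eq_fun do rewrite big_cons; exact: trigD.
Qed.

Lemma trig_prod (I : Type) (s : seq I) (F : I -> point -> R[i]) :
  (forall i, trig (F i)) -> trig (fun z => \prod_(i <- s) F i z).
Proof.
move=> HF; elim: s => [|i s IH].
  by under eq_fun do rewrite big_nil; exact: trig_cst.
by under eq_fun do rewrite big_cons; exact: trigM.
Qed.

Lemma trig_poly_fun (q : mpoly.mpoly N R[i]) : trig (poly_fun q).
Proof.
rewrite /poly_fun (_ : (fun z => _) = (fun z : point => \sum_(m <- mpoly.msupp q)
  mpoly.mcoeff m q * \prod_i z 0 i ^+ mpoly.fun_of_multinom m i)).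
  apply: trig_sum => m; apply: trigM; first exact: trig_cst.
  by apply: trig_prod => i; apply: trigX; exact: trig_coord.
by apply/funext => z; rewrite mpoly.mevalE.
Qed.

Lemma trig_measurable f : trig f ->
  measurable_fun [set: point] (@complex.Re R \o f) /\
  measurable_fun [set: point] (@complex.Im R \o f).
Proof.
have mRe k : measurable_fun [set: point] (fun z : point => complex.Re (z 0 k)).
  apply: (measurableT_comp (continuous_measurable_real _ continuous_Re)).
  exact: measurable_coord.
have mIm k : measurable_fun [set: point] (fun z : point => complex.Im (z 0 k)).
  apply: (measurableT_comp (continuous_measurable_real _ continuous_Im)).
  exact: measurable_coord.
elim=> [c|k|k|{}f g _ [Hf1 Hf2] _ [Hg1 Hg2]|{}f g _ [Hf1 Hf2] _ [Hg1 Hg2]].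
- by split; exact: measurable_cst.
- by split; [exact: mRe|exact: mIm].
- split.
    rewrite (_ : _ \o _ = (fun z : point => complex.Re (z 0 k))); first exact: mRe.
    by apply/funext => z /=; case: (z 0 k).
  rewrite (_ : _ \o _ = (fun z : point => - complex.Im (z 0 k))).
    exact: measurableT_comp (mIm k).
  by apply/funext => z /=; case: (z 0 k).
- split.
    rewrite (_ : _ \o _ = (@complex.Re R \o f) \+ (@complex.Re R \o g)).
      exact: measurable_funD.
    by apply/funext => z /=; rewrite raddfD.
  rewrite (_ : _ \o _ = (@complex.Im R \o f) \+ (@complex.Im R \o g)).
    exact: measurable_funD.
  by apply/funext => z /=; rewrite raddfD.
- split.
    rewrite (_ : _ \o _ = ((@complex.Re R \o f) \* (@complex.Re R \o g)) \-
      ((@complex.Im R \o f) \* (@complex.Im R \o g))).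
      by apply: measurable_funB; exact: measurable_funM.
    by apply/funext => z /=; case: (f z) => a b; case: (g z).
  rewrite (_ : _ \o _ = ((@complex.Re R \o f) \* (@complex.Im R \o g)) \+
      ((@complex.Im R \o f) \* (@complex.Re R \o g))).
    by apply: measurable_funD; exact: measurable_funM.
  by apply/funext => z /=; case: (f z) => a b; case: (g z).
Qed.

Lemma trig_normc_measurable f : trig f ->
  measurable_fun [set: point] (fun z => normc (f z)).
Proof.
move=> /trig_measurable[m1 m2].
rewrite (_ : (fun z => _) = (fun z => Num.sqrt (complex.Re (f z) ^+ 2 + complex.Im (f z) ^+ 2))).
  apply: (@measurableT_comp _ _ _ _ _ _ (@Num.sqrt R)).
    exact: (@continuous_measurable_fun R _ (@sqrt_continuous R)).
  by apply: measurable_funD; apply: measurable_funX.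
by apply/funext => z; case: (f z).
Qed.

Lemma trig_bounded f : trig f ->
  exists2 K : R, 0 <= K & forall z, torus N z -> normc (f z) <= K.
Proof.
elim=> [c|k|k|{}f g _ [K K0 HK] _ [L L0 HL]|{}f g _ [K K0 HK] _ [L L0 HL]].
- by exists (normc c) => //; exact: normc_ge0.
- by exists 1 => // z /(_ k) ->.
- by exists 1 => // z /(_ k); rewrite normcJ => ->.
- exists (K + L); first exact: addr_ge0.
  by move=> z zT; rewrite (le_trans (le_normcD _ _))// lerD ?HK ?HL.
- exists (K * L); first exact: mulr_ge0.
  by move=> z zT; rewrite normcM ler_pM ?normc_ge0 ?HK ?HL.
Qed.

(** On the torus the conjugate of [z_k] is [1 / z_k], hence a high power of the
product of the coordinates clears all negative exponents. *)
Lemma trig_lift f : trig f -> exists (q : mpoly.mpoly N R[i]) m,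
  forall z, torus N z -> f z * (\prod_i z 0 i) ^+ m = poly_fun q z.
Proof.
elim=> [c|k|k|{}f g _ [q [m qE]] _ [h [l hE]]|{}f g _ [q [m qE]] _ [h [l hE]]].
- exists (mpoly.mpolyC _ c), 0%N => z _; rewrite expr0 mulr1.
  by rewrite /poly_fun mpoly.mevalC.
- exists (mpoly.mpolyX _ (mpoly.mnm1 k)), 0%N => z _; rewrite expr0 mulr1.
  by rewrite /poly_fun mpoly.mevalXU.
- exists (\prod_(i | i != k) mpoly.mpolyX _ (mpoly.mnm1 i)), 1%N => z zT.
  rewrite /poly_fun rmorph_prod expr1 (bigD1 k)//=.
  rewrite mulrA [_^*%C * _]mulrC -normc_sqrC zT expr1n mul1r.
  by apply: eq_bigr => i _; rewrite mpoly.mevalXU.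
- exists (q * coord_prod ^+ l + h * coord_prod ^+ m), (m + l)%N => z zT.
  rewrite poly_funD /= !poly_funM !poly_funX coord_prodE -qE// -hE//.
  by rewrite mulrDl exprD -!mulrA [_ ^+ l * _ ^+ m]mulrC.
- exists (q * h), (m + l)%N => z zT.
  by rewrite poly_funM -qE// -hE// exprD mulrACA.
Qed.

End trig.

Section rotation.
Context {R : realType} {n : nat}.
Local Notation point := 'rV[R[i]]_n.+1.

Definition rot (c : R[i]) (z : point) : point := set_coord z ord0 (c * z 0 ord0).

Lemma rotE c z k : rot c z 0 k = if k == ord0 then c * z 0 ord0 else z 0 k.
Proof. by rewrite mxE. Qed.

Lemma torus_rot c z : normc c = 1 -> torus n.+1 (rot c z) <-> torus n.+1 z.
Proof.
move=> c1; split=> zT k; have := zT k; rewrite rotE;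
  by case: eqP => // ->; rewrite normcM c1 mul1r.
Qed.

Lemma coord_prod_rot c z : \prod_i rot c z 0 i = c * \prod_i z 0 i.
Proof.
rewrite !big_ord_recl rotE eqxx mulrA; congr (_ * _).
by apply: eq_bigr => i _; rewrite rotE.
Qed.

(** Slow variation: small rotations of the first coordinate move a trigonometric
polynomial little, uniformly on the torus. *)
Lemma trig_rot f : trig f -> forall tau : R, 0 < tau ->
  exists2 d : R, 0 < d & forall t z, `|t| < d -> torus n.+1 z ->
    normc (f (rot (circle_map t) z) - f z) <= tau.
Proof.
elim=> [c|k|k|{}f g _ Hf _ Hg|{}f g trf Hf trg Hg] tau tau0.
- by exists 1 => // t z _ _; rewrite subrr normc0 ltW.
- have [d d0 H] := circle_near1 _ tau0; exists d => // t z td zT.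
  rewrite rotE; case: eqP => [->|_]; last by rewrite subrr normc0 ltW.
  by rewrite -{2}[z 0 _]mul1r -mulrBl normcM zT mulr1 H.
- have [d d0 H] := circle_near1 _ tau0; exists d => // t z td zT.
  rewrite -rmorphB normcJ rotE; case: eqP => [->|_]; last by rewrite subrr normc0 ltW.
  by rewrite -{2}[z 0 _]mul1r -mulrBl normcM zT mulr1 H.
- have [d d0 Hd] := Hf (tau / 2) ltac:(by rewrite divr_gt0).
  have [c c0 Hc] := Hg (tau / 2) ltac:(by rewrite divr_gt0).
  exists (Num.min d c); first by rewrite lt_min d0.
  move=> t z; rewrite lt_min => /andP[td tc] zT.
  rewrite opprD addrACA (splitr tau) (le_trans (le_normcD _ _))// lerD ?Hd ?Hc//.
- have [K K0 HK] := trig_bounded _ trf; have [L L0 HL] := trig_bounded _ trg.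
  have K1 : 0 < K + 1 by rewrite ltr_pwDr. have L1 : 0 < L + 1 by rewrite ltr_pwDr.
  have [d d0 Hd] := Hf (tau / 2 / (L + 1)) ltac:(by rewrite !divr_gt0).
  have [c c0 Hc] := Hg (tau / 2 / (K + 1)) ltac:(by rewrite !divr_gt0).
  exists (Num.min d c); first by rewrite lt_min d0.
  move=> t z; rewrite lt_min => /andP[td tc] zT.
  set w := rot _ z; have wT : torus n.+1 w by rewrite torus_rot ?normc_circle.
  have -> : f w * g w - f z * g z = (f w - f z) * g w + f z * (g w - g z).
    by rewrite mulrBl mulrBr addrA subrK.
  rewrite (splitr tau) (le_trans (le_normcD _ _))// !normcM lerD//.
    rewrite -[leRHS](@divfK _ (L + 1)) ?gt_eqF// ler_pM ?normc_ge0 ?Hd//.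
    by rewrite (le_trans (HL _ wT))// lerDl.
  rewrite mulrC -[leRHS](@divfK _ (K + 1)) ?gt_eqF// ler_pM ?normc_ge0 ?Hc//.
  by rewrite (le_trans (HK _ zT))// lerDl.
Qed.

End rotation.

(** * Uniform density of trigonometric polynomials on the torus *)

Section fejer_kernel.
Context {R : realType}.
Variable (L : nat).
Hypothesis L0 : (0 < L)%N.
Local Notation om j := (@unity_root R L ^+ j).

Definition dirichlet (j : nat) (t : R[i]) : R[i] :=
  \sum_(a < L) t ^+ a * (om j)^-1 ^+ a.

Definition fejer (j : nat) (t : R[i]) : R := normc (dirichlet j t / L%:R) ^+ 2.

Lemma fejer_ge0 j t : 0 <= fejer j t.
Proof. exact: sqr_ge0. Qed.

Lemma fejerE j t : fejer j t = (L%:R ^+ 2)^-1 * normc (dirichlet j t) ^+ 2.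
Proof. by rewrite /fejer normcM normcV normc_nat exprMn exprVn mulrC. Qed.

Lemma fejer_sum1 t : normc t = 1 -> \sum_(j < L) fejer j t = 1.
Proof.
move=> t1; under eq_bigr do rewrite fejerE.
rewrite -mulr_sumr; under eq_bigr do rewrite /dirichlet -(horner_poly _ (fun a => t ^+ a)).
rewrite (ker_l2 _ L)// t1 expr1n; under eq_bigr do rewrite expr1n.
by rewrite sumr_const card_ord -expr2 mulVf// expf_neq0// pnatr_eq0 -lt0n.
Qed.

Lemma fejer_dist t j : normc t = 1 ->
  fejer j t * normc (t - om j) ^+ 2 <= 4 / L%:R ^+ 2.
Proof.
move=> t1; rewrite fejerE -mulrA mulrC ler_wpM2r ?invr_ge0 ?sqr_ge0//.
rewrite -exprMn -normcM.
have oj0 : om j != 0 by rewrite -normc_gt0 normc_unity.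
have -> : dirichlet j t * (t - om j) = (t ^+ L - 1) * om j.
  have -> : t - om j = (t * (om j)^-1 - 1) * om j by rewrite mulrBl mul1r divfK.
  rewrite mulrA; congr (_ * _); rewrite /dirichlet.
  under eq_bigr do rewrite -exprMn.
  rewrite mulrC -subrX1 exprMn exprVn -exprM mulnC exprM unity_rootX//.
  by rewrite expr1n invr1 mulr1.
rewrite normcM normc_unity mulr1 (_ : 4 = 2 ^+ 2 :> R); last by ring.
rewrite lerXn2r ?nnegrE ?normc_ge0// (le_trans (normcB _ _))//.
by rewrite normcX t1 expr1n normc1.
Qed.

(** The second moment decides the convergence, as for Bernstein polynomials:
[fejer_dist] bounds each of the [L] terms by [4 / L^2], because multiplying the
Dirichlet kernel by [t - om j] telescopes. *)
Lemma fejer_moment2 t : normc t = 1 ->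
  \sum_(j < L) fejer j t * normc (t - om j) ^+ 2 <= 4 / L%:R.
Proof.
move=> t1; apply: (@le_trans _ _ (\sum_(j < L) 4 / L%:R ^+ 2)).
  by apply: ler_sum => j _; exact: fejer_dist.
rewrite sumr_const card_ord -[leLHS]mulr_natl expr2 invfM [leLHS]mulrC.
by rewrite -!mulrA mulVf ?mulr1// pnatr_eq0 -lt0n.
Qed.

Section product.
Context {N : nat}.
Local Notation point := 'rV[R[i]]_N.
Local Notation index := {ffun 'I_N -> 'I_L}.

Definition fejerN (J : index) (z : point) : R := \prod_k fejer (J k) (z 0 k).

Lemma fejerN_ge0 J z : 0 <= fejerN J z.
Proof. by apply: prodr_ge0 => k _; exact: fejer_ge0. Qed.

Lemma fejerN_sum1 z : torus N z -> \sum_J fejerN J z = 1.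
Proof.
move=> zT; rewrite /fejerN -(bigA_distr_bigA (fun k (j : 'I_L) => fejer j (z 0 k))).
by apply: big1 => k _; exact: fejer_sum1.
Qed.

Lemma fejerN_moment2 z i : torus N z ->
  \sum_J fejerN J z * normc (z 0 i - om (J i)) ^+ 2 <= 4 / L%:R.
Proof.
move=> zT.
pose F k (j : 'I_L) := fejer j (z 0 k) * (if k == i then normc (z 0 i - om j) ^+ 2 else 1).
have -> : \sum_J fejerN J z * normc (z 0 i - om (J i)) ^+ 2 =
    \sum_(J : index) \prod_k F k (J k).
  apply: eq_bigr => J _; rewrite /F big_split /=; congr (_ * _).
  by rewrite -big_mkcond /= big_pred1_eq.
rewrite -(bigA_distr_bigA F) (bigD1 i)//= [X in _ * X]big1 ?mulr1; last first.
  move=> k ki; rewrite /F (negPf ki); under eq_bigr do rewrite mulr1.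
  exact: fejer_sum1.
by rewrite /F eqxx; exact: fejer_moment2.
Qed.

Definition node (J : index) : point := \row_k om (J k).

Lemma torus_node J : torus N (node J).
Proof. by move=> k; rewrite mxE normc_unity. Qed.

Definition fejer_approx (phi : point -> R[i]) (z : point) : R[i] :=
  \sum_J phi (node J) * \prod_k
    ((dirichlet (J k) (z 0 k) / L%:R) * (dirichlet (J k) (z 0 k) / L%:R)^*%C).

Lemma trig_fejer_approx phi : trig (fejer_approx phi).
Proof.
apply: trig_sum => J; apply: trigM; first exact: trig_cst.
apply: trig_prod => k.
have T : trig (fun z : point => dirichlet (J k) (z 0 k) / L%:R).
  apply: trigM; last exact: trig_cst.
  apply: trig_sum => a; apply: trigM; last exact: trig_cst.
  by apply: trigX; exact: trig_coord.
exact: (trigM _ _ T (trigJ _ T)).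
Qed.

Lemma fejer_approxE phi z :
  fejer_approx phi z = \sum_J phi (node J) * (fejerN J z)%:C%C.
Proof.
apply: eq_bigr => J _; congr (_ * _).
rewrite /fejerN (big_morph _ (@rmorphM _ _ (real_complex R)) (rmorph1 _)).
by apply: eq_bigr => k _; rewrite -normc_sqrC.
Qed.

Lemma fejer_approx_le phi (e C : R) z : torus N z -> 0 <= C ->
  (forall w, torus N w -> normc (phi w - phi z) <=
     e + C * \sum_k normc (z 0 k - w 0 k) ^+ 2) ->
  normc (fejer_approx phi z - phi z) <= e + C * (N%:R * (4 / L%:R)).
Proof.
move=> zT C0 H.
have -> : fejer_approx phi z - phi z =
    \sum_J (phi (node J) - phi z) * (fejerN J z)%:C%C.
  under eq_bigr do rewrite mulrBl; rewrite sumrB fejer_approxE; congr (_ - _).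
  by rewrite -mulr_sumr -sumrC fejerN_sum1// mulr1.
apply: (le_trans (normc_sum _ _ _ _)).
apply: (@le_trans _ _ (\sum_J (e * fejerN J z + C * \sum_k
    fejerN J z * normc (z 0 k - om (J k)) ^+ 2))).
  apply: ler_sum => J _; rewrite normcM normcC (ger0_norm (fejerN_ge0 _ _)).
  rewrite -mulr_sumr mulrCA [e * _]mulrC -mulrDr [leLHS]mulrC ler_wpM2l ?fejerN_ge0//.
  apply: le_trans (H _ (torus_node J)) _; rewrite lerD2l.
  by under eq_bigr do rewrite mxE.
rewrite big_split /= -mulr_sumr fejerN_sum1// mulr1 lerD2l -[leLHS]mulr_sumr.
rewrite ler_wpM2l// exchange_big /=.
apply: (@le_trans _ _ (\sum_(k < N) 4 / L%:R)).
  by apply: ler_sum => k _; exact: fejerN_moment2.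
by rewrite sumr_const card_ord -[leLHS]mulr_natl.
Qed.

End product.
End fejer_kernel.

Section uniform_approximation.
Context {R : realType} {N : nat}.
Local Notation point := 'rV[R[i]]_N.

Lemma compact_torus : compact (@torus R N).
Proof.
pose circ : set R[i] := @circle_map R @` `[0, 1]%classic.
have cc : compact circ.
  apply: continuous_compact; last exact: segment_compact.
  by apply: continuous_subspaceT => t; exact: continuous_circle_map.
have -> : @torus R N = [set v : point | forall k, circ (v 0 k)].
  apply/seteqP; split => z zT k.
    by have [t t01 <-] := circle_surj _ (zT k); exists t.
  by have [t _ <-] := zT k; rewrite normc_circle.
exact: (@rV_compact R[i] N (fun=> circ)).
Qed.

Lemma within_torus_near (phi : point -> R[i]) : {within torus N, continuous phi} ->
  forall x (e : R), torus N x -> 0 < e ->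
  exists2 d : R, 0 < d & forall z, torus N z ->
    (forall k, normc (x 0 k - z 0 k) < d) -> normc (phi x - phi z) <= e.
Proof.
move=> /subspace_continuousP cphi x e xT e0.
have := cphi x xT => /cvgrPdist_le /(_ e%:C%C); rewrite ltcR => /(_ e0).
rewrite near_withinE => /nbhs_ballP [d d0 H].
have := d0; rewrite /= ltcE /= => /andP[/eqP d1 d0'].
exists (complex.Re d) => // z zT xz.
rewrite -lecR -normCE; apply: H => //; split=> // i j; rewrite ord1.
by rewrite /ball /= normCE ltcE /= d1 eqxx xz.
Qed.

Lemma torus_uniform (phi : point -> R[i]) (e : R) :
  {within torus N, continuous phi} -> 0 < e ->
  exists2 d : R, 0 < d & forall w z, torus N w -> torus N z ->
    (forall k, normc (w 0 k - z 0 k) < d) -> normc (phi w - phi z) <= e.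
Proof.
move=> cphi e0.
have /compact_near_coveringP H := compact_torus.
pose P (d : R) (w : point) := torus N w -> forall z, torus N z ->
  (forall k, normc (w 0 k - z 0 k) < d) -> normc (phi w - phi z) <= e.
have : \forall d \near 0^'+, @torus R N `<=` P d.
  apply: H => x xT.
  have [d d0 D] := within_torus_near _ cphi x (e / 2) xT ltac:(by rewrite divr_gt0).
  have d2 : 0 < d / 2 by rewrite divr_gt0.
  exists ([set w | torus N w -> forall k, normc (x 0 k - w 0 k) < d / 2], [set i | i < d / 2]).
    split => /=; last exact: nbhs_right_lt.
    apply/nbhs_ballP; exists (d / 2)%:C%C; first by rewrite /= ltcR.
    by move=> w [_ xw] _ k; have := xw 0 k; rewrite /ball /= normCE ltcR.
  move=> [w i] /= [xw id2] wT z zT wz.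
  have -> : phi w - phi z = (phi x - phi z) - (phi x - phi w).
    by rewrite opprB [RHS]addrC [RHS]addrA subrK.
  rewrite (splitr e) (le_trans (normcB _ _))// lerD// D// => k.
    have -> : x 0 k - z 0 k = (x 0 k - w 0 k) + (w 0 k - z 0 k) by rewrite addrA subrK.
    rewrite (splitr d) (le_lt_trans (le_normcD _ _))// ltrD ?xw//.
    exact: lt_trans (wz k) id2.
  by rewrite (lt_trans (xw wT k))// [ltRHS]splitr ltrDl.
rewrite near_withinE => -[d /= d0 K].
have d2 : 0 < d / 2 by rewrite divr_gt0.
exists (d / 2) => // w z wT; apply: (K (d / 2)) => //.
by rewrite /ball /= sub0r normrN gtr0_norm// [ltRHS]splitr ltrDl.
Qed.

Lemma torus_bounded (phi : point -> R[i]) : {within torus N, continuous phi} ->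
  exists2 B : R, 0 <= B & forall z, torus N z -> normc (phi z) <= B.
Proof.
move=> cphi; have /compact_near_coveringP H := compact_torus.
pose P (B : R) (w : point) := torus N w -> normc (phi w) <= B.
have : \forall B \near +oo, @torus R N `<=` P B.
  apply: H => x xT.
  have [d d0 D] := within_torus_near _ cphi x 1 xT ltr01.
  exists ([set w : point | forall k, normc (x 0 k - w 0 k) < d], [set B | normc (phi x) + 1 <= B]).
    split => /=; last by apply: nbhs_pinfty_ge; rewrite num_real.
    apply/nbhs_ballP; exists d%:C%C; first by rewrite /= ltcR.
    by move=> w [_ xw] k; have := xw 0 k; rewrite /ball /= normCE ltcR.
  move=> [w B] /= [xw xB] wT; apply: le_trans xB.
  rewrite -lerBlDl; apply: le_trans (lerB_normc _ _) _.
  by rewrite normcBC; exact: D.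
move=> [B [_ K]]; exists (`|B| + 1); first by rewrite addr_ge0.
move=> z zT; apply: (K (`|B| + 1)) => //.
by rewrite (le_lt_trans (ler_norm _))// ltrDl.
Qed.

(** Korovkin's argument: by uniform continuity the oscillation of [phi] is at
most [eps / 2] plus a multiple of the squared distance, and the Fejer means of
the latter are of order [1 / L]. *)
Theorem trig_dense (phi : point -> R[i]) (eps : R) :
  {within torus N, continuous phi} -> 0 < eps ->
  exists2 f, trig f & forall z, torus N z -> normc (f z - phi z) <= eps.
Proof.
move=> cphi eps0; have e20 : 0 < eps / 2 by rewrite divr_gt0.
have [d d0 D] := torus_uniform _ _ cphi e20.
have [B B0 HB] := torus_bounded _ cphi.
pose C := 2 * B / d ^+ 2.
have C0 : 0 <= C by apply: divr_ge0; [exact: mulr_ge0|exact: sqr_ge0].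
have CN0 : 0 <= C * (N%:R * 4) by apply: mulr_ge0 => //; exact: mulr_ge0.
(* The successor keeps [L] positive. *)
pose L := (Num.Def.archi_bound (C * (N%:R * 4) / (eps / 2))).+1.
exists (fejer_approx L phi); first exact: trig_fejer_approx.
move=> z zT; apply: (le_trans (@fejer_approx_le R L isT N phi (eps / 2) C z zT C0 _)).
  move=> w wT; have S0 : 0 <= \sum_k normc (z 0 k - w 0 k) ^+ 2.
    by apply: sumr_ge0 => k _; exact: sqr_ge0.
  have [zw|] := pselect (forall k, normc (w 0 k - z 0 k) < d).
    by apply: (le_trans (D _ _ wT zT zw)); rewrite lerDl mulr_ge0.
  move=> /existsNP[k /negP]; rewrite -leNgt normcBC => dk.
  apply: (@le_trans _ _ (C * d ^+ 2)).
    rewrite /C divfK ?gt_eqF ?exprn_gt0// (le_trans (normcB _ _))//.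
    have := HB _ zT; have := HB _ wT; lra.
  apply: (@le_trans _ _ (C * \sum_k normc (z 0 k - w 0 k) ^+ 2)); last by rewrite lerDr ltW.
  rewrite ler_wpM2l// (bigD1 k)//= (le_trans (_ : _ <= normc (z 0 k - w 0 k) ^+ 2))//.
    by rewrite lerXn2r ?nnegrE ?normc_ge0// ltW.
  by rewrite lerDl; apply: sumr_ge0 => j _; exact: sqr_ge0.
have -> : C * (N%:R * (4 / L%:R)) = C * (N%:R * 4) / L%:R by rewrite !mulrA.
rewrite [leRHS]splitr lerD2l ler_pdivrMr ?ltr0n// [leRHS]mulrC -ler_pdivrMr//.
apply: ltW; apply: lt_le_trans (archi_boundP _) _; first by apply: divr_ge0 => //; exact: ltW.
by rewrite ler_nat.
Qed.

End uniform_approximation.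

(** * Rotation invariance of the measure on the torus *)

Section translation.
Context {R : realType}.
Local Notation mu := (@lebesgue_measure R).

(** A translation as a self-map of the measurable line, so that it can be used
to push measures forward. *)
Definition translate (a : R) (x : measurableTypeR R) : measurableTypeR R := x + a.

Lemma measurable_translate a : measurable_fun [set: _] (translate a).
Proof. exact: measurable_funD. Qed.

HB.instance Definition _ a :=
  isMeasurableFun.Build _ _ _ _ (translate a) (measurable_translate a).

Lemma lebesgue_measure_translate a (A : set (measurableTypeR R)) : measurable A ->
  mu (translate a @^-1` A) = mu A.
Proof.
move=> mA.
apply/esym/(@lebesgue_measure_unique R (pushforward mu (translate a))) => //= _ [[x y]] _ <-.
rewrite /pushforward.
have -> : translate a @^-1` `]x, y]%classic = `]x - a, y - a]%classic.
  by apply/seteqP; split => t /=; rewrite /translate !in_itv /= ltrBlDr lerBrDr.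
rewrite /= !lebesgue_measure_itv /= !lte_fin ltrD2r; case: ifP => // _.
by rewrite -!EFinD; congr (_%:E); ring.
Qed.

End translation.

Section circle_measure.
Context {R : realType}.
Local Notation mu := (@lebesgue_measure R).

Lemma uniform_probE (U : set (measurableTypeR R)) : measurable U ->
  uniform_prob (@ltr01 R) U = mu (U `&` `]0, 1]%classic).
Proof.
move=> mU; rewrite /uniform_prob integral_uniform_pdf.
rewrite (eq_integral (cst 1%E)); last first.
  by move=> x /[!inE] -[_] /=; rewrite in_itv /= /uniform_pdf => ->; rewrite subr0 invr1.
rewrite integral_cst ?mul1e; last exact: measurableI.
have -> : `[0 : R, 1]%classic = `[0, 0]%classic `|` `]0, 1]%classic.
  by rewrite -itv_bndbnd_setU// bnd_simp.
rewrite setIUr measureU; [|exact: measurableI..|].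
  rewrite [X in (X + _)%E](_ : _ = 0%E) ?add0e//.
  apply/eqP; rewrite eq_le measure_ge0 andbT.
  apply: (@le_trans _ _ (mu `[0, 0]%classic)); last first.
    by rewrite lebesgue_measure_itv /= lte_fin ltxx.
  by apply: le_measure; rewrite ?inE//; exact: measurableI.
apply/seteqP; split => // x /= [[_ +] [_ +]].
by rewrite !in_itv /= => /andP[_ x0] /andP[]; rewrite ltNge x0.
Qed.

(** Cut the unit interval at [1 - c]: the two pieces are translated by [c] and
[c - 1] onto the pieces of the interval cut at [c]. *)
Lemma periodic_measure_rot (B : set (measurableTypeR R)) (c : R) : 0 <= c <= 1 ->
  measurable B -> (forall t, B (t + 1) <-> B t) ->
  mu (translate c @^-1` B `&` `]0, 1]%classic) = mu (B `&` `]0, 1]%classic).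
Proof.
move=> /andP[c0 c1] mB per.
have split01 (x : R) (X : set (measurableTypeR R)) : 0 <= x <= 1 -> measurable X ->
    mu (X `&` `]0, 1]%classic) = (mu (X `&` `]0%R, x]%classic) + mu (X `&` `]x, 1%R]%classic))%E.
  move=> /andP[x0 x1] mX.
  rewrite -measureU; [|exact: measurableI..|].
    by rewrite -setIUr -itv_bndbnd_setU// bnd_simp.
  apply/seteqP; split => // t /= [[_ +] [_ +]].
  by rewrite !in_itv /= => /andP[_ tx] /andP[]; rewrite ltNge tx.
have mcB : measurable (translate c @^-1` B).
  by rewrite -[X in measurable X]setTI; exact: measurable_translate.
rewrite (split01 (1 - c))//; last by lra.
rewrite (split01 c B)//; last by lra.
rewrite addeC; congr (_ + _)%E.
  rewrite -(lebesgue_measure_translate (c - 1) (B `&` _)); last exact: measurableI.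
  congr (mu _); apply/seteqP; split => t /=; rewrite /translate !in_itv /= => -[tB tc].
    by split; [apply/per; rewrite (_ : _ + 1 = t + c)//; ring|lra].
  by split; [move/per: tB; rewrite (_ : _ + 1 = t + c)//; ring|lra].
rewrite -(lebesgue_measure_translate c (B `&` _)); last exact: measurableI.
congr (mu _); apply/seteqP; split => t /=; rewrite /translate !in_itv /= => -[tB tc].
  by split => //; lra.
by split => //; lra.
Qed.

Lemma sigma1_rot (c : R) (A : set R[i]) : 0 <= c <= 1 -> measurable A ->
  sigma1 R ((fun z => circle_map c * z) @^-1` A) = sigma1 R A.
Proof.
move=> c01 mA; rewrite /sigma1 /distribution /pushforward.
have mB : measurable ((@circle_map R : measurableTypeR R -> R[i]) @^-1` A).
  by rewrite -[X in measurable X]setTI; exact: measurable_circle_map.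
transitivity (uniform_prob (@ltr01 R)
    (translate c @^-1` ((@circle_map R : measurableTypeR R -> R[i]) @^-1` A))).
  congr (uniform_prob _ _).
  by apply/seteqP; split => t /=; rewrite /translate circleD mulrC.
rewrite /= !uniform_probE//; last first.
  by rewrite -[X in measurable X]setTI; exact: measurable_translate.
by apply: periodic_measure_rot => // t /=; rewrite circleD circle1 mulr1.
Qed.

Lemma measurable_unit_circle : measurable [set z : R[i] | normc z = 1].
Proof.
have H : measurable_fun [set: R[i]] (fun z => complex.Re z ^+ 2 + complex.Im z ^+ 2).
  by apply: measurable_funD; apply: measurable_funX;
    apply: continuous_measurable_real; [exact: continuous_Re|exact: continuous_Im].
have -> : [set z : R[i] | normc z = 1] =
    (fun z => complex.Re z ^+ 2 + complex.Im z ^+ 2) @^-1` [set 1].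
  apply/seteqP; split => z /=; rewrite -normc_sqr => z1; first by rewrite z1 expr1n.
  by apply/eqP; rewrite -(@pexpr_eq1 _ _ 2)// ?normc_ge0// z1.
by rewrite -[X in measurable X]setTI; exact: H.
Qed.

Lemma sigma1_circle : sigma1 R [set z | normc z = 1] = 1%E.
Proof.
rewrite -(probability_setT (uniform_prob (@ltr01 R))) /sigma1 /distribution /pushforward.
congr (uniform_prob _ _); apply/seteqP; split => // t _; exact: normc_circle.
Qed.

End circle_measure.

Section torus_measure.
Context {R : realType}.

Lemma measurable_torus N : measurable (@torus R N).
Proof.
have -> : @torus R N = \bigcap_(k in [set: 'I_N]) [set z | normc (z 0 k) = 1].
  by apply/seteqP; split => [z zT k _|z zT k]; apply: zT.
apply: fin_bigcap_measurable => // k _.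
have := @measurable_coord R N k measurableT _ measurable_unit_circle.
by rewrite setTI.
Qed.

Lemma cons_rVE n (p : R[i] * 'rV[R[i]]_n) (k : 'I_n.+1) :
  cons_rV p 0 k = if unlift ord0 k is Some j then p.2 0 j else p.1.
Proof.
case: unliftP => [j|] ->.
  have -> : lift ord0 j = rshift 1 j by exact/val_inj.
  exact: row_mxEr (p.1)%:M p.2 0 j.
have -> : ord0 = lshift n ord0 :> 'I_(1 + n) by exact/val_inj.
by apply: etrans (row_mxEl (p.1)%:M p.2 0 ord0) _; rewrite mxE eqxx.
Qed.

Lemma cons_rV_torus n : @cons_rV R n @^-1` torus n.+1 = [set z | normc z = 1] `*` torus n.
Proof.
apply/seteqP; split => -[z w] /=.
  move=> H; split => [|k]; first by have := H ord0; rewrite cons_rVE unlift_none.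
  by have := H (lift ord0 k); rewrite cons_rVE liftK.
by move=> [/= z1 wT] k; rewrite cons_rVE; case: unliftP.
Qed.

Lemma sigma_torus N : sigma N (@torus R N) = 1%E.
Proof.
elim: N => [|n IH].
  by rewrite /= diracE mem_set// => -[].
transitivity ((sigma1 R \x sigma n)%E ([set z | normc z = 1] `*` torus n)).
  by rewrite -cons_rV_torus.
rewrite product_measure1E.
- by have := @sigma1_circle R; rewrite /= => ->; rewrite [X in (_ * X)%E]IH mule1.
- exact: measurable_unit_circle.
- exact: measurable_torus.
Qed.

Lemma measurable_mulc (c : R[i]) : measurable_fun [set: R[i]] (fun z => c * z).
Proof.
have cc : continuous (fun z : R[i] => c * z).
  move=> z; apply: (@cvgM _ _ (nbhs z) (nbhs_filter z) (fun=> c) id).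
    exact: cvg_cst.
  exact: cvg_id.
apply: (@measurability _ _ _ _ _ _ (@open R[i])) => //.
move=> _ [U oU <-]; rewrite setTI; apply: sub_sigma_algebra.
by apply: open_comp => // z _; exact: cc.
Qed.

Lemma measurable_rot n (c : R[i]) : measurable_fun [set: 'rV[R[i]]_n.+1] (rot c).
Proof.
apply: (@measurability _ _ _ _ _ _
  (\big[setU/set0]_(k < n.+1) preimage_set_system setT
    (fun z : 'rV[R[i]]_n.+1 => z 0 k) measurable)) => //.
move=> _ [B + <-]; rewrite -bigcup_seq/= => -[k _ [A mA <-]].
rewrite !setTI -comp_preimage.
suff : measurable_fun setT (fun z : 'rV[R[i]]_n.+1 => rot c z 0 k).
  by move=> /(_ measurableT _ mA); rewrite setTI.
under eq_fun do rewrite rotE.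
case: eqP => _; last exact: measurable_coord.
exact: measurableT_comp (measurable_mulc c) (measurable_coord ord0).
Qed.

HB.instance Definition _ n (c : R[i]) :=
  isMeasurableFun.Build _ _ _ _ (@rot R n c) (@measurable_rot n c).

(** Fubini reduces the statement to the first coordinate. *)
Lemma sigma_rot n (c : R) (A : set 'rV[R[i]]_n.+1) : 0 <= c <= 1 -> measurable A ->
  sigma n.+1 (rot (circle_map c) @^-1` A) = sigma n.+1 A.
Proof.
move=> c01 mA; rewrite /= /distribution /pushforward.
have fub (X : set (R[i] * 'rV[R[i]]_n)) : measurable X ->
    (sigma1 R \x sigma n)%E X = (\int[sigma n]_y sigma1 R (ysection X y))%E.
  move=> mX; transitivity ((sigma1 R \x^ sigma n)%E X); last by [].
  by apply: product_measure_unique => //= ? ? ? ?; rewrite product_measure2E.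
have mcons (X : set 'rV[R[i]]_n.+1) : measurable X -> measurable (@cons_rV R n @^-1` X).
  by move=> mX; rewrite -[Y in measurable Y]setTI; exact: measurable_cons_rV.
have mrA : measurable (rot (circle_map c) @^-1` A).
  by rewrite -[Y in measurable Y]setTI; exact: measurable_rot.
rewrite !fub; [|exact: mcons..].
apply: eq_integral => y _; rewrite -[RHS](sigma1_rot c)//; last first.
  by apply: measurable_ysection; exact: mcons.
congr (sigma1 R _); apply/seteqP.
have E z : rot (circle_map c) (cons_rV (z, y)) = cons_rV (circle_map c * z, y).
  apply/rowP => k; rewrite rotE !cons_rVE unlift_none.
  by case: unliftP => [j|] -> /=.
by split => z /=; rewrite /ysection /= !inE /= E.
Qed.

End torus_measure.

Section mean.
Context {R : realType} {n : nat}.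
Local Notation point := 'rV[R[i]]_n.+1.
Local Notation T := (@torus R n.+1).
Local Notation s := (@sigma R n.+1).

Definition tame (F : point -> R) := measurable_fun [set: point] F /\
  exists B : R, forall z, T z -> `|F z| <= B.

Definition mean (F : point -> R) : R := \int[s]_(z in T) F z.

Lemma tame_integrable F : tame F -> s.-integrable T (EFin \o F).
Proof.
move=> [mF [B FB]]; apply: measurable_bounded_integrable.
- exact: measurable_torus.
- by rewrite [ltLHS]sigma_torus ltry.
- exact: measurable_funTS.
- exists B; split; first by rewrite num_real.
  by move=> x Bx z zT /=; apply: le_trans (FB z zT) (ltW Bx).
Qed.

Lemma tameD F G : tame F -> tame G -> tame (fun z => F z + G z).
Proof.
move=> [mF [B FB]] [mG [C GC]]; split; first exact: measurable_funD.
by exists (B + C) => z zT; rewrite (le_trans (ler_normD _ _))// lerD ?FB ?GC.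
Qed.

Lemma tameZ a F : tame F -> tame (fun z => a * F z).
Proof.
move=> [mF [B FB]]; split; first exact: measurable_funM.
by exists (`|a| * B) => z zT; rewrite normrM ler_wpM2l// FB.
Qed.

Lemma tame_cst a : tame (fun=> a).
Proof. by split; [exact: measurable_cst|exists `|a|]. Qed.

Lemma tame_rot c F : normc c = 1 -> tame F -> tame (F \o rot c).
Proof.
move=> c1 [mF [B FB]]; split; first exact: measurableT_comp (measurable_rot _ c).
by exists B => z zT; apply: FB; rewrite torus_rot.
Qed.

Lemma le_mean F G : tame F -> tame G -> (forall z, T z -> F z <= G z) ->
  mean F <= mean G.
Proof.
by move=> tF tG FG; apply: le_Rintegral => //; [exact: measurable_torus|exact: tame_integrable..].
Qed.

Lemma meanD F G : tame F -> tame G -> mean (fun z => F z + G z) = mean F + mean G.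
Proof.
by move=> tF tG; apply: RintegralD; [exact: measurable_torus|exact: tame_integrable..].
Qed.

Lemma meanZ a F : tame F -> mean (fun z => a * F z) = a * mean F.
Proof.
by move=> tF; apply: RintegralZl; [exact: measurable_torus|exact: tame_integrable].
Qed.

Lemma mean_cst a : mean (fun=> a) = a.
Proof.
rewrite /mean Rintegral_cst; last exact: measurable_torus.
by rewrite [X in fine X]sigma_torus mulr1.
Qed.

Lemma mean_rot c F : 0 <= c <= 1 -> tame F -> mean (F \o rot (circle_map c)) = mean F.
Proof.
move=> c01 tF; rewrite /mean /Rintegral; congr fine.
have mT := @measurable_torus R n.+1.
transitivity (\int[pushforward s (rot (circle_map c))]_(z in T) (F z)%:E)%E; last first.
  by apply: eq_measure_integral => A mA _; exact: sigma_rot.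
rewrite (integral_pushforward (measurable_rot _ _))//.
- congr (integral _ _ _); apply/seteqP; split => z /=; rewrite torus_rot//; exact: normc_circle.
- by apply/measurable_EFinP; case: tF.
- have -> : rot (circle_map c) @^-1` T = T.
    by apply/seteqP; split => z /=; rewrite torus_rot// normc_circle.
  by apply: tame_integrable; apply: tame_rot => //; exact: normc_circle.
Qed.

Lemma measurable_superlevel F (a : R) : measurable_fun [set: point] F ->
  measurable (T `&` [set z | a <= F z]).
Proof.
move=> mF; rewrite (_ : [set z | _] = F @^-1` `[a, +oo[%classic); last first.
  by apply/seteqP; split => z /=; rewrite in_itv /= andbT.
apply: measurableI => //; first exact: measurable_torus.
rewrite -[X in measurable X]setTI.
by apply: mF => //; exact: measurable_itv.
Qed.

Lemma markov_mean F (a : R) : tame F -> (forall z, T z -> 0 <= F z) -> 0 <= a ->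
  (a%:E * s (T `&` [set z | (a <= F z)%R]) <= (mean F)%:E)%E.
Proof.
move=> tF F0 a0; have mT := @measurable_torus R n.+1.
have mA := measurable_superlevel F a tF.1.
rewrite /mean /Rintegral fineK; last first.
  by have := integrable_fin_num mT (tame_integrable _ tF).
rewrite -integral_cst//.
apply: (@le_trans _ _ (\int[s]_(z in T `&` [set z | (a <= F z)%R]) (F z)%:E)%E).
  apply: ge0_le_integral => //.
  - by apply/measurable_EFinP; exact: measurable_funTS tF.1.
  - by move=> z [_ /= Fa]; rewrite lee_fin.
apply: ge0_subset_integral => //.
  by apply/measurable_EFinP; exact: measurable_funTS tF.1.
Qed.

End mean.

(** * One step of the walk, pointwise *)

Section pointwise.
Context {R : realType}.
Implicit Types (w x v : R[i]).

(** This is [log+ |w|], a Lyapunov function for the walk outside the unit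
disc. *)
Definition logplus w : R := ln (Num.max 1 (normc w)).

Lemma max1_gt0 (t : R) : 0 < Num.max 1 t.
Proof. by rewrite lt_max ltr01. Qed.

Lemma logplus_ge0 w : 0 <= logplus w.
Proof. by rewrite ln_ge0// le_max lexx. Qed.

Lemma logplus_small w : normc w <= 1 -> logplus w = 0.
Proof. by move=> w1; rewrite /logplus (max_idPl _)// ln1. Qed.

Lemma logplus_large w : 1 <= normc w -> logplus w = ln (normc w).
Proof. by move=> w1; rewrite /logplus (max_idPr _). Qed.

Lemma logplus_lipschitz v w : logplus v <= logplus w + normc (v - w).
Proof.
set t := normc _; have t0 : 0 <= t by exact: normc_ge0.
have t1 : 0 < 1 + t by rewrite ltr_pwDl.
apply: (@le_trans _ _ (logplus w + ln (1 + t))).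
  rewrite -lnM ?posrE ?max1_gt0// ler_ln ?posrE ?mulr_gt0 ?max1_gt0//.
  set m := Num.max 1 (normc w); have m1 : 1 <= m by rewrite le_max lexx.
  have mw : normc w <= m by rewrite le_max lexx orbT.
  have mt : t <= m * t by rewrite ler_peMl.
  rewrite mulrDr mulr1 ge_max; apply/andP; split; first by lra.
  have : normc v <= normc w + t by rewrite -{1}(subrKC w v) le_normcD.
  lra.
by rewrite lerD2l (le_trans (le_ln1Dx _))//; lra.
Qed.

(** The discrete mean value property of [log |w|], in multiplicative form: the
geometric mean over the four rotations is [|w^4 - x^4|^(1/4)], which is [|w|] up
to a term of order four in [x]. *)
Lemma prod_rotations w x :
  \prod_(k < 4) (w - 'i%C ^+ k * x) = w ^+ 4 - x ^+ 4.
Proof.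
have i2 := @sqr_i R; rewrite !big_ord_recr big_ord0 /=.
ring: i2.
Qed.

Lemma sum_rotations w x :
  \sum_(k < 4) normc (w - 'i%C ^+ k * x) ^+ 2 = 4 * (normc w ^+ 2 + normc x ^+ 2).
Proof.
rewrite !big_ord_recr big_ord0 /= !normc_sqr; case: w => a b; case: x => p q.
by rewrite !exprS expr0 /=; ring.
Qed.

End pointwise.

Section step_size.
Context {R : realType}.
Variables (S d : R).
Hypotheses (S1 : 1 <= S) (d0 : 0 < d) (dS : 2 * d * S ^+ 3 <= 1).
Implicit Types (w x : R[i]).

(** The signed length of the step made at gap [w]; it vanishes on the circles of
radius [1] and [S]. *)
Definition step w : R := d * (S ^+ 2 - normc w ^+ 2) * (normc w ^+ 2 - 1).

Let S0 : 0 < S. Proof. by apply: lt_le_trans S1. Qed.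

Lemma step_le w : normc w <= S -> `|step w| <= d * S ^+ 4.
Proof.
move=> wS; have w0 := normc_ge0 w; set t := normc w in wS w0 *.
have t2 : t ^+ 2 <= S ^+ 2 by apply: lerXn2r => //; rewrite nnegrE ltW.
have S2 : 1 <= S ^+ 2 by exact: exprn_ege1.
have t20 := sqr_ge0 t.
rewrite /step -/t !normrM (gtr0_norm d0) -mulrA ler_wpM2l ?(ltW d0)//.
rewrite (_ : S ^+ 4 = S ^+ 2 * S ^+ 2); last by ring.
apply: ler_pM => //; rewrite ler_norml; lra.
Qed.

Lemma step_outer w x : normc w <= S -> normc x = `|step w| -> normc (w - x) <= S.
Proof.
move=> wS xw; apply: (le_trans (normcB _ _)); rewrite xw.
have w0 := normc_ge0 w; rewrite /step; set t := normc w in wS w0 *.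
have S2 : 1 <= S ^+ 2 by exact: exprn_ege1.
have t20 := sqr_ge0 t.
have t2 : t ^+ 2 <= S ^+ 2 by apply: lerXn2r => //; rewrite nnegrE ltW.
have K : `|t ^+ 2 - 1| <= S ^+ 2 by rewrite ler_norml; lra.
rewrite normrM ger0_norm; last by rewrite mulr_ge0 ?(ltW d0)// subr_ge0.
rewrite -lerBrDl; apply: (@le_trans _ _ (d * (S ^+ 2 - t ^+ 2) * S ^+ 2)).
  by rewrite ler_wpM2l// mulr_ge0 ?(ltW d0)// subr_ge0.
have -> : d * (S ^+ 2 - t ^+ 2) * S ^+ 2 = (S - t) * (d * (S + t) * S ^+ 2) by ring.
rewrite ler_piMr ?subr_ge0//; apply: le_trans dS.
have -> : 2 * d * S ^+ 3 = d * (S + S) * S ^+ 2 by ring.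
by rewrite ler_wpM2r ?sqr_ge0// ler_wpM2l ?(ltW d0)// lerD2l.
Qed.

(** The factor [|w|^2 - 1] keeps the walk on its side of the unit circle. *)
Lemma step_barrier w : normc w <= S -> `|step w| <= `|normc w - 1|.
Proof.
move=> wS; have w0 := normc_ge0 w; rewrite /step; set t := normc w in wS w0 *.
have t20 := sqr_ge0 t.
have t2 : t ^+ 2 <= S ^+ 2 by apply: lerXn2r => //; rewrite nnegrE ltW.
have -> : d * (S ^+ 2 - t ^+ 2) * (t ^+ 2 - 1) = (t - 1) * (d * (S ^+ 2 - t ^+ 2) * (t + 1)).
  by ring.
rewrite normrM ler_piMr// ger0_norm; last first.
  by apply: mulr_ge0; [apply: mulr_ge0; [exact: ltW|rewrite subr_ge0]|lra].
apply: le_trans dS; have -> : 2 * d * S ^+ 3 = d * S ^+ 2 * (S + S) by ring.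
rewrite ler_pM//.
- by rewrite mulr_ge0 ?(ltW d0)// subr_ge0.
- lra.
- by rewrite ler_wpM2l ?(ltW d0)//; lra.
- exact: lerD.
Qed.

Lemma step_inner w x : normc w <= S -> normc w <= 1 -> normc x = `|step w| ->
  normc (w - x) <= 1.
Proof.
move=> wS w1 xw; have := step_barrier _ wS; rewrite -xw.
rewrite ler0_norm; last by rewrite subr_le0.
have := normcB w x; lra.
Qed.

Lemma step_annulus w x : normc w <= S -> 1 <= normc w -> normc x = `|step w| ->
  1 <= normc (w - x).
Proof.
move=> wS w1 xw; have := step_barrier _ wS; rewrite -xw.
rewrite ger0_norm; last by rewrite subr_ge0.
have := lerB_normc w x; lra.
Qed.

(** Inside the unit disc [logplus] vanishes before and after the step.  Outside,
no step leaves the region where [logplus] is the logarithm, and [prod_rotations] applies. *)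
Lemma logplus_step w x : normc w <= S -> normc x = `|step w| ->
  \sum_(k < 4) logplus (w - 'i%C ^+ k * x) <= 4 * logplus w + normc x ^+ 4.
Proof.
move=> wS xw.
have ni : normc ('i%C : R[i]) = 1 by rewrite /= expr0n /= add0r expr1n sqrtr1.
have nx k : normc ('i%C ^+ k * x) = `|step w| by rewrite normcM normcX ni expr1n mul1r.
have [w1|w1] := leP (normc w) 1.
  rewrite big1 => [|k _]; first by rewrite logplus_small// mulr0 add0r exprn_ge0// normc_ge0.
  by rewrite logplus_small// step_inner.
have w0 : 0 < normc w by exact: lt_trans w1.
have pos k : 1 <= normc (w - 'i%C ^+ k * x) by apply: step_annulus => //; exact: ltW.
have lnprod (I : seq 'I_4) : \sum_(k <- I) logplus (w - 'i%C ^+ k * x) =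
    ln (\prod_(k <- I) normc (w - 'i%C ^+ k * x)).
  elim: I => [|k I IH]; first by rewrite !big_nil ln1.
  have pos0 j : 0 < normc (w - 'i%C ^+ j * x) by exact: lt_le_trans (pos j).
  rewrite !big_cons IH logplus_large// lnM// posrE//.
  by apply: prodr_gt0 => j _.
rewrite lnprod -normc_prod prod_rotations (logplus_large _ (ltW w1)).
have x0 : 0 <= normc x ^+ 4 by rewrite exprn_ge0 ?normc_ge0.
have w4 : 1 <= normc w ^+ 4 by apply: exprn_ege1; exact: ltW.
have w40 : 0 < normc w ^+ 4 by rewrite exprn_gt0.
apply: (@le_trans _ _ (ln (normc w ^+ 4 * (1 + normc x ^+ 4)))).
  have K : normc (w ^+ 4 - x ^+ 4) <= normc w ^+ 4 * (1 + normc x ^+ 4).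
    apply: (le_trans (normcB _ _)); rewrite !normcX mulrDr mulr1 lerD2l.
    by rewrite ler_peMl.
  have K0 : 0 < normc (w ^+ 4 - x ^+ 4).
    rewrite -prod_rotations normc_prod; apply: prodr_gt0 => j _.
    exact: lt_le_trans (pos _).
  by rewrite ler_ln// posrE// (lt_le_trans K0).
rewrite lnM ?posrE ?ltr_pwDl// lnXn// mulr_natl lerD2l.
by rewrite (le_trans (le_ln1Dx _))//; lra.
Qed.

End step_size.

(** * One step of the walk, on average *)

Section mean_rotations.
Context {R : realType} {n : nat}.
Local Notation point := 'rV[R[i]]_n.+1.
Local Notation T := (@torus R n.+1).

Lemma tame_sum (m : nat) (F : 'I_m -> point -> R) : (forall k, tame (F k)) ->
  tame (fun z => \sum_(k < m) F k z).
Proof.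
move=> tF; elim: (index_enum _) => [|k s IH].
  by under eq_fun do rewrite big_nil; exact: tame_cst.
by under eq_fun do rewrite big_cons; exact: tameD.
Qed.

Lemma mean_sum (m : nat) (F : 'I_m -> point -> R) : (forall k, tame (F k)) ->
  mean (fun z => \sum_(k < m) F k z) = \sum_(k < m) mean (F k).
Proof.
move=> tF; suff [] : tame (fun z => \sum_(k < m) F k z) /\
  mean (fun z => \sum_(k < m) F k z) = \sum_(k < m) mean (F k) by [].
elim: (index_enum _) => [|k s [IH1 IH2]].
  under eq_fun do rewrite big_nil; rewrite big_nil mean_cst.
  by split => //; exact: tame_cst.
under eq_fun do rewrite big_cons; rewrite big_cons -IH2 meanD//.
by split => //; exact: tameD.
Qed.

(** The substitute for independence: since rotations preserve the mean, it is
enough to compare averages over finitely many rotations pointwise. *)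
Lemma le_mean_rotations (m : nat) (c : 'I_m -> R) (G H : point -> R) :
  (0 < m)%N -> (forall k, 0 <= c k <= 1) -> tame G -> tame H ->
  (forall z, T z -> \sum_(k < m) G (rot (circle_map (c k)) z) <= m%:R * H z) ->
  mean G <= mean H.
Proof.
move=> m0 c01 tG tH GH.
have tGr k : tame (G \o rot (circle_map (c k))).
  by apply: tame_rot => //; exact: normc_circle.
rewrite -(@ler_pM2l _ m%:R) ?ltr0n// -[leRHS]meanZ//.
have -> : m%:R * mean G = \sum_(k < m) mean (G \o rot (circle_map (c k))).
  under eq_bigr do rewrite mean_rot//.
  by rewrite sumr_const card_ord mulr_natl.
rewrite -mean_sum//; apply: le_mean => //; first exact: tame_sum.
exact: tameZ.
Qed.

End mean_rotations.

Section tame_trig.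
Context {R : realType} {n : nat}.
Local Notation point := 'rV[R[i]]_n.+1.
Implicit Types (W : point -> R[i]).

Lemma tameX (F : point -> R) k : tame F -> tame (fun z => F z ^+ k).
Proof.
move=> [mF [B FB]]; split; first exact: measurable_funX.
exists (B ^+ k) => z zT; rewrite normrX lerXn2r ?nnegrE ?FB//.
by rewrite (le_trans _ (FB z zT)).
Qed.

Lemma tame_normc W : trig W -> tame (fun z => normc (W z)).
Proof.
move=> tW; split; first exact: trig_normc_measurable.
by have [K _ HK] := trig_bounded _ tW; exists K => z /HK; rewrite ger0_norm ?normc_ge0.
Qed.

Lemma tame_logplus W : trig W -> tame (fun z => logplus (W z)).
Proof.
move=> tW; split.
  apply: (@measurableT_comp _ _ _ _ _ _ (@ln R)); first exact: measurable_ln.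
  by apply: measurable_maxr => //; exact: trig_normc_measurable.
have [K _ HK] := trig_bounded _ tW; exists K => z /HK WK.
rewrite ger0_norm ?logplus_ge0//; apply: le_trans WK.
by have := logplus_lipschitz (W z) 0; rewrite (@logplus_small _ 0) ?normc0 ?ler01// add0r subr0.
Qed.

Lemma tame_step S d W : trig W -> tame (fun z => step S d (W z)).
Proof.
move=> tW; have tW2 := tameX _ 2 (tame_normc _ tW).
have E : (fun z => step S d (W z)) = (fun z => d * S ^+ 2 * normc (W z) ^+ 2 +
    (d * normc (W z) ^+ 2 + ((- d) * (normc (W z) ^+ 2) ^+ 2 + - d * S ^+ 2))).
  by apply/funext => z; rewrite /step; ring.
rewrite E; apply: tameD; first exact: tameZ.
apply: tameD; first exact: tameZ.
by apply: tameD; [apply: tameZ; exact: tameX|exact: tame_cst].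
Qed.

Lemma trig_step S d W : trig W -> trig (fun z => (step S d (W z))%:C%C).
Proof.
move=> tW.
have E : (fun z => (step S d (W z))%:C%C) =
  (fun z => d%:C%C * ((S ^+ 2)%:C%C + - (W z * (W z)^*%C)) * (W z * (W z)^*%C + - 1)).
  by apply/funext => z; rewrite /step !rmorphM !rmorphB /= normc_sqrC !rmorph1 rmorphM.
have tn := trigM _ _ tW (trigJ _ tW).
rewrite E; apply: trigM; first apply: trigM; first exact: trig_cst.
  by apply: trigD; [exact: trig_cst|exact: trigN].
by apply: trigD => //; exact: trig_cst.
Qed.

End tame_trig.

Lemma lerN1_add {R : realType} (a b e : R) : (- 1 * a <= - 1 * b + e) = (b - e <= a).
Proof. by apply/idP/idP; lra. Qed.

Section walk.
Context {R : realType} {n : nat}.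
Local Notation point := 'rV[R[i]]_n.+1.
Local Notation T := (@torus R n.+1).
Local Notation polynomial := (mpoly.mpoly n.+1 R[i]).
Variables (S d : R) (Phi : point -> R[i]).
Hypotheses (S1 : 1 <= S) (d0 : 0 < d) (dS : 2 * d * S ^+ 3 <= 1) (trPhi : trig Phi).
Implicit Types (h : polynomial).

Definition gap h (z : point) : R[i] := Phi z - poly_fun h z.

Lemma trig_gap h : trig (gap h).
Proof. by apply: trigD => //; apply: trigN; exact: trig_poly_fun. Qed.

(** Rotations by angles [k / (4 M)], which are as small as desired while their
[M]-th powers are the powers of [i]. *)
Lemma rotations_exist (d1 : R) m : 0 < d1 -> exists2 M, (m <= M)%N &
  forall k : 'I_4, let c : R := k%:R / (4 * M%:R) in
    [/\ 0 <= c <= 1, c < d1 & circle_map c ^+ M = 'i%C ^+ k].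
Proof.
move=> d10; pose M := (m + (Num.Def.archi_bound d1^-1)).+1.
exists M; first by rewrite leqW// leq_addr.
have M1 : d1^-1 < M%:R.
  apply: lt_le_trans (archi_boundP _) _; first by rewrite invr_ge0 ltW.
  by rewrite ler_nat leqW// leq_addl.
have M0 : 0 < M%:R :> R by rewrite ltr0n.
move=> k; have k4 : (k%:R : R) <= 4 by rewrite ler_nat ltnW.
have kM : k%:R / (4 * M%:R) <= M%:R^-1 :> R.
  by rewrite invfM mulrA ler_piMl ?invr_ge0 ?(ltW M0)// ler_pdivrMr// mul1r.
have dM : M%:R^-1 < d1 by rewrite -[d1]invrK ltf_pV2 ?posrE ?invr_gt0.
split.
- by rewrite divr_ge0 ?mulr_ge0 ?ler0n//= (le_trans kM)// invf_le1// ler1n.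
- exact: le_lt_trans dM.
- rewrite -circleMn -circle_quarter -circleMn; congr circle_map.
  by field; rewrite !pnatr_eq0.
Qed.

(** The mean square rises by the mean of [step ^+ 2], the mean of [logplus] by a
fourth order quantity only. *)
Lemma walk_step h (B eta : R) : d * S ^+ 4 <= B -> 0 < eta ->
  (forall z, T z -> normc (gap h z) <= S) ->
  (forall k z, polydisc n.+1 z -> bloch_coef (poly_fun h) k z <= B) ->
  exists h', [/\ forall z, T z -> normc (gap h' z) <= S,
    poly_fun h' 0 = poly_fun h 0,
    forall k z, polydisc n.+1 z -> bloch_coef (poly_fun h') k z <= B + eta,
    mean (fun z => normc (gap h z) ^+ 2) + mean (fun z => step S d (gap h z) ^+ 2) - eta
      <= mean (fun z => normc (gap h' z) ^+ 2) &
    mean (fun z => logplus (gap h' z)) <= mean (fun z => logplus (gap h z)) +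
      (d * S ^+ 4) ^+ 2 / 4 * mean (fun z => step S d (gap h z) ^+ 2) + eta].
Proof.
move=> AB eta0 hS hB; set A := d * S ^+ 4 in AB *.
have S0 : 0 < S by exact: lt_le_trans S1.
set W := gap h in hS *; have tW : trig W by exact: trig_gap.
pose a z : R[i] := (step S d (W z))%:C%C; have ta : trig a by exact: trig_step.
have na z : normc (a z) = `|step S d (W z)| by rewrite normcC.
have aA z : T z -> normc (a z) <= A.
  by move=> zT; rewrite na; apply: step_le => //; exact: hS.
have [q [m qE]] := trig_lift _ ta.
have Z1 z : T z -> normc (\prod_i z 0 i) = 1.
  by move=> zT; rewrite normc_prod big1.
have qA z : T z -> normc (poly_fun q z) <= A.
  by move=> zT; rewrite -qE// normcM normcX Z1// expr1n mulr1 aA.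
have [l0 Hl0] := bloch_step h q A B eta AB eta0 qA hB.
(* Moduli are at most [S], so an error [2 tau] costs at most [eta] on squares;
it costs at most [2 tau] on [logplus], which is Lipschitz. *)
pose tau := eta / (4 * S).
have tau0 : 0 < tau by rewrite divr_gt0 ?mulr_gt0.
have tauS : tau * (4 * S) = eta by rewrite divfK// mulf_neq0// gt_eqF.
have [d1 d10 Wd] := trig_rot _ tW tau tau0.
have [d2 d20 ad] := trig_rot _ ta tau tau0.
have [M mM HM] := @rotations_exist (Num.min d1 d2) (m + l0).+1 ltac:(by rewrite lt_min d10).
pose c (k : 'I_4) : R := k%:R / (4 * M%:R).
have c01 k : 0 <= c k <= 1 by have [] := HM k.
pose l := (M - m)%N.
have mlM : (m + l = M)%N by rewrite subnKC// (leq_trans _ mM)// leqW// leq_addr.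
have ll0 : (l0 <= l)%N by rewrite -(leq_add2l m) mlM (leq_trans _ mM).
have l1 : (0 < l)%N by rewrite -(ltn_add2l m) addn0 mlM (leq_trans _ mM)// ltnS leq_addr.
exists (h + q * coord_prod ^+ l).
set W' := gap _; have tW' : trig W' by exact: trig_gap.
pose x z := a z * (\prod_i z 0 i) ^+ M.
have xE z : T z -> normc (x z) = `|step S d (W z)|.
  by move=> zT; rewrite normcM normcX Z1// expr1n mulr1.
have W'E z : T z -> W' z = W z - x z.
  move=> zT; rewrite /W' /W /gap poly_funD /= poly_funM poly_funX coord_prodE -qE//.
  by rewrite /x -mlM exprD mulrA opprD addrA.
have W'S z : T z -> normc (W' z) <= S.
  by move=> zT; rewrite W'E//; apply: (@step_outer _ S d) => //; [exact: hS|exact: xE].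
(* The idealised step in direction [k], which the rotated gap approximates. *)
pose v (k : 'I_4) z := W z - 'i%C ^+ k * x z.
have vS k z : T z -> normc (v k z) <= S.
  move=> zT; apply: (@step_outer _ S d) => //; first exact: hS.
  by rewrite normcM normcX xE// /= expr0n /= add0r expr1n sqrtr1 expr1n mul1r.
have near k z : T z -> normc (W' (rot (circle_map (c k)) z) - v k z) <= 2 * tau.
  move=> zT; have [_ cd cM] := HM k; rewrite -/(c k) in cd cM.
  have cn : `|c k| < Num.min d1 d2 by rewrite ger0_norm//; case/andP: (c01 k).
  move: cn; rewrite lt_min => /andP[cd1 cd2].
  rewrite W'E ?torus_rot ?normc_circle// /x coord_prod_rot exprMn cM.
  set wr := W _; set ar := a _; set P := (\prod_i z 0 i) ^+ M.
  have -> : wr - ar * ('i%C ^+ k * P) - v k z =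
      (wr - W z) - (ar - a z) * ('i%C ^+ k * P).
    by rewrite /v /x -/P; ring.
  apply: (le_trans (normcB _ _)); rewrite mulr_natl mulr2n lerD ?Wd//.
  rewrite normcM normcM !normcX Z1// expr1n mulr1.
  rewrite [normc 'i%C](_ : _ = 1) ?expr1n ?mulr1 ?ad//.
  by rewrite /= expr0n /= add0r expr1n sqrtr1.
have tW2 := tameX _ 2 (tame_normc _ tW); have tW'2 := tameX _ 2 (tame_normc _ tW').
have ts2 := tameX _ 2 (tame_step S d _ tW).
have tL := tame_logplus _ tW; have tL' := tame_logplus _ tW'.
split.
- exact: W'S.
- rewrite poly_funD /= poly_funM poly_funX coord_prodE big_ord_recl mxE.
  by rewrite mul0r expr0n gtn_eqF// mulr0 addr0.
- exact: Hl0.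
- have tH : tame (fun z => - 1 * (normc (W z) ^+ 2 + step S d (W z) ^+ 2) + eta).
    by apply: tameD; [apply: tameZ; exact: tameD|exact: tame_cst].
  have := @le_mean_rotations _ _ 4 c (fun z => - 1 * normc (W' z) ^+ 2) _ isT c01
    (tameZ _ _ tW'2) tH.
  rewrite meanD; [|by apply: tameZ; exact: tameD|exact: tame_cst].
  rewrite mean_cst !meanZ//; last exact: tameD.
  rewrite meanD// lerN1_add; apply => z zT; have sq : normc (x z) ^+ 2 = step S d (W z) ^+ 2.
    by rewrite xE// real_normK// num_real.
  have P (k : 'I_4) : - 1 * normc (W' (rot (circle_map (c k)) z)) ^+ 2 <=
      - 1 * normc (v k z) ^+ 2 + eta.
    have := near k z zT; have := vS k z zT.
    have : normc (W' (rot (circle_map (c k)) z)) <= S.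
      by apply: W'S; rewrite torus_rot// normc_circle.
    set u := W' _ => uS vkS uv.
    have vu : normc (v k z) <= normc u + 2 * tau.
      rewrite -lerBlDl (le_trans (lerB_normc _ _))// normcBC//.
    have := normc_ge0 u; have := normc_ge0 (v k z).
    move: (normc u) (normc (v k z)) uS vkS vu => s t sS tS ts t0 s0.
    clear - S0 tau0 tauS sS tS ts t0 s0.
    have K1 : (t - s) * (t + s) <= 2 * tau * (S + S).
      apply: (@le_trans _ _ (2 * tau * (t + s))).
        by rewrite ler_wpM2r ?addr_ge0//; lra.
      by rewrite ler_wpM2l ?lerD// mulr_ge0// ltW.
    have K2 : (t - s) * (t + s) = t ^+ 2 - s ^+ 2 by ring.
    have K3 : 2 * tau * (S + S) = eta by rewrite -tauS; ring.
    move: K1; rewrite K2 K3; lra.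
  apply: (le_trans (ler_sum _ (fun k _ => P k))).
  rewrite big_split /= -mulr_sumr sum_rotations sq sumr_const card_ord -mulr_natl.
  by rewrite le_eqVlt; apply/orP; left; apply/eqP; ring.
- have tH : tame (fun z => logplus (W z) + (A ^+ 2 / 4 * step S d (W z) ^+ 2 + eta)).
    by apply: tameD => //; apply: tameD; [exact: tameZ|exact: tame_cst].
  have := @le_mean_rotations _ _ 4 c (fun z => logplus (W' z)) _ isT c01 tL' tH.
  rewrite !meanD//; [|exact: tameZ|exact: tame_cst|by apply: tameD; [exact: tameZ|exact: tame_cst]].
  rewrite mean_cst meanZ// addrA; apply => z zT.
  have tau2 : 2 * tau <= eta.
    rewrite -tauS [2 * _]mulrC ler_wpM2l ?(ltW tau0)//.
    by apply: (@le_trans _ _ (4 * 1)); [rewrite mulr1 ler_nat|rewrite ler_pM2l].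
  have P (k : 'I_4) : logplus (W' (rot (circle_map (c k)) z)) <= logplus (v k z) + eta.
    apply: (le_trans (logplus_lipschitz _ (v k z))); rewrite lerD2l.
    exact: le_trans (near k z zT) tau2.
  apply: (le_trans (ler_sum _ (fun k _ => P k))).
  rewrite big_split /= sumr_const card_ord -mulr_natl.
  have := @logplus_step _ S d S1 d0 dS (W z) (x z) (hS z zT) (xE z zT).
  have : normc (x z) ^+ 4 <= A ^+ 2 * step S d (W z) ^+ 2.
    have e : normc (x z) ^+ 4 = normc (x z) ^+ 2 * step S d (W z) ^+ 2.
      by rewrite -[step _ _ _ ^+ 2]real_normK ?num_real// -xE//; ring.
    rewrite e ler_wpM2r ?sqr_ge0// lerXn2r ?nnegrE ?normc_ge0//.
      by rewrite (le_trans _ (aA z zT)) ?normc_ge0.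
    by rewrite xE// -na aA.
  rewrite /v; lra.
Qed.

End walk.

(** * The walk stops near the target *)

Lemma energy_budget {R : realType} (a k e x U U' V L L' : R) : 0 <= a ->
  U + V - e <= U' -> L <= k + a * (U + x * e) + x * e -> L' <= L + a * V + e ->
  L' <= k + a * (U' + (x + 1) * e) + (x + 1) * e.
Proof.
move=> a0 UV LU L'L; have : a * (U + V) <= a * (U' + e) by rewrite ler_wpM2l//; lra.
lra.
Qed.

Section walk_run.
Context {R : realType} {n : nat}.
Local Notation point := 'rV[R[i]]_n.+1.
Local Notation T := (@torus R n.+1).
Local Notation polynomial := (mpoly.mpoly n.+1 R[i]).

Lemma poly_fun0 (z : point) : poly_fun (0 : polynomial) z = 0.
Proof. exact: mpoly.meval0. Qed.

Lemma bloch_coef0 k (z : point) : bloch_coef (poly_fun (0 : polynomial)) k z = 0.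
Proof.
have [|_ E] := partialE (poly_fun (0 : polynomial)) k z 0.
  by move=> t; rewrite poly_fun0 horner0.
by rewrite /bloch_coef E deriv0 horner0 normc0 mulr0.
Qed.

(** As long as the mean of [step ^+ 2] exceeds [beta] the mean square rises by
at least [beta - eta] per step, and the rise of the mean square also pays for
the rise of the mean of [logplus]. *)
Lemma walk_run (S d K beta eta : R) (Phi : point -> R[i]) m :
  1 <= K -> K <= S -> 0 < d -> 2 * d * S ^+ 3 <= 1 -> trig Phi -> 0 < eta ->
  (forall z, T z -> normc (Phi z) <= K) ->
  let A := d * S ^+ 4 in
  exists h, let W := gap Phi h in let U := mean (fun z => normc (W z) ^+ 2) in
  let V := mean (fun z => step S d (W z) ^+ 2) in
  [/\ forall z, T z -> normc (W z) <= S,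
      poly_fun h 0 = 0,
      forall k z, polydisc n.+1 z -> bloch_coef (poly_fun h) k z <= A + m%:R * eta,
      mean (fun z => logplus (W z)) <=
        ln K + A ^+ 2 / 4 * (U + m%:R * eta) + m%:R * eta
    & V <= beta \/ m%:R * (beta - eta) <= U].
Proof.
move=> K1 KS d0 dS tPhi eta0 PhiK A.
have S1 : 1 <= S by exact: le_trans KS.
have S0 : 0 < S by exact: lt_le_trans ltr01 S1.
have A0 : 0 <= A by apply: mulr_ge0; [exact: ltW|apply: exprn_ge0; exact: ltW].
elim: m => [|m [h [hS h0 hB hL hV]]].
  have g0 z : gap Phi 0 z = Phi z by rewrite /gap poly_fun0 subr0.
  have U0 : 0 <= mean (fun z => normc (gap Phi 0 z) ^+ 2).
    rewrite -[leLHS](@mean_cst _ n) le_mean//; first exact: tame_cst.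
      by apply/tameX/tame_normc/trig_gap.
    by move=> z _; exact: sqr_ge0.
  exists 0; split; rewrite ?mul0r ?addr0.
  - by move=> z zT; rewrite g0 (le_trans (PhiK z zT)).
  - exact: poly_fun0.
  - by move=> k z _; rewrite bloch_coef0.
  - apply: (@le_trans _ _ (ln K)); last first.
      by rewrite lerDl mulr_ge0// divr_ge0// sqr_ge0.
    rewrite -[leRHS](@mean_cst _ n) le_mean//; [|exact: tame_cst|].
      exact/tame_logplus/trig_gap.
    move=> z zT; rewrite g0 ler_ln ?posrE ?max1_gt0 ?(lt_le_trans ltr01)//.
    by rewrite ge_max K1 PhiK.
  - by right.
have mS : m.+1%:R = m%:R + 1 :> R by rewrite -natr1.
have [V1|V1] := leP (mean (fun z => step S d (gap Phi h z) ^+ 2)) beta.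
  exists h; split => //; last by left.
    move=> k z zD; apply: (le_trans (hB k z zD)).
    by rewrite lerD2l ler_wpM2r ?(ltW eta0)// ler_nat.
  apply: (le_trans hL); have mm : m%:R * eta <= m.+1%:R * eta.
    by rewrite ler_wpM2r ?(ltW eta0)// ler_nat.
  by rewrite lerD// lerD2l ler_wpM2l ?divr_ge0 ?sqr_ge0// lerD2l.
case: hV => [|hV]; first by rewrite leNgt V1.
have AB : A <= A + m%:R * eta by rewrite lerDl; apply: mulr_ge0 => //; exact: ltW.
have [h' [h'S h'0 h'B h'U h'L]] := walk_step _ _ _ S1 d0 dS tPhi h _ _ AB eta0 hS hB.
exists h'; split.
- exact: h'S.
- by rewrite h'0.
- by move=> k z zD; apply: (le_trans (h'B k z zD)); rewrite mS mulrDl mul1r addrA.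
- rewrite mS; apply: energy_budget h'U hL h'L.
  by rewrite divr_ge0// sqr_ge0.
- right; apply: le_trans h'U; rewrite mS mulrDl mul1r addrA lerD2r.
  by apply: lerD => //; exact: ltW.
Qed.

End walk_run.

Section correction.
Context {R : realType} {n : nat}.
Local Notation point := 'rV[R[i]]_n.+1.
Local Notation T := (@torus R n.+1).
Local Notation s := (@sigma R n.+1).

Lemma markov_sigma F (a e : R) : tame F -> (forall z, T z -> 0 <= F z) -> 0 < a ->
  mean F <= a * e -> (s (T `&` [set z | (a <= F z)%R]) <= e%:E)%E.
Proof.
move=> tF F0 a0 Fe; have := markov_mean F a tF F0 (ltW a0).
case: (s _) => [p| |]; last by rewrite leNye.
  by rewrite -EFinM !lee_fin => H; rewrite -(@ler_pM2l _ a)// (le_trans H).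
by rewrite gt0_muley ?lte_fin.
Qed.

Lemma log_budget (k a y t z : R) : a * y <= a * (t + 4^-1) -> a * t <= 1 -> a <= 1 ->
  z <= 4^-1 -> k + a / 4 * y + z <= k + 1.
Proof. by lra. Qed.

(** The bound [A] on the step length is at most [1 / S], so that the total rise
of [logplus], at most [A^2 S^2] up to a constant, does not depend on [S].  Then
[S] can be chosen exponentially large in [ln K / eps], which makes it unlikely
that the walk gets close to the outer circle. *)
Theorem trig_correction (Phi : point -> R[i]) (eps b : R) :
  trig Phi -> 0 < eps -> 0 < b ->
  exists E (h : mpoly.mpoly n.+1 R[i]),
    [/\ measurable E, E `<=` T, ((1 - eps)%:E <= s E)%E, poly_fun h 0 = 0 &
        (forall k z, polydisc n.+1 z -> bloch_coef (poly_fun h) k z <= b) /\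
        (forall z, E z -> normc (Phi z - poly_fun h z) <= 2)].
Proof.
move=> tPhi eps0 b0; have [K' K'0 PhiK'] := trig_bounded _ tPhi.
pose K := K' + 1; have K1 : 1 <= K by rewrite lerDr.
have lnK0 : 0 <= ln K by exact: ln_ge0.
have PhiK z : T z -> normc (Phi z) <= K by move=> /PhiK' H; rewrite (le_trans H)// lerDl.
(* [ln K + 1] bounds the final mean of [logplus], and Markov's inequality at level
[q] has to yield [eps / 2]. *)
pose q := 2 * (ln K + 1) / eps; have q0 : 0 < q.
  by rewrite divr_gt0// mulr_gt0// ltr_pwDr.
pose S := 2 * (expR q + K).
have e1 := expR_gt0 q.
have KS : K <= S by rewrite /S; lra.
have S2 : 2 <= S by rewrite /S; lra.
have S1 : 1 <= S by lra.
have S0 : 0 < S by lra.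
pose A := Num.min (b / 2) S^-1.
have A0 : 0 < A by rewrite lt_min divr_gt0//= invr_gt0.
have A1 : A <= 1.
  by rewrite (le_trans (_ : _ <= S^-1)) ?invf_le1// ge_min lexx orbT.
have Ab : A <= b / 2 by rewrite ge_min lexx.
have AS : A <= S^-1 by rewrite ge_min lexx orbT.
pose d := A / S ^+ 4; have d0 : 0 < d by rewrite divr_gt0// exprn_gt0.
have dA : d * S ^+ 4 = A by rewrite divfK// expf_neq0// gt_eqF.
have AS1 : A * S <= 1 by rewrite -ler_pdivlMr// mul1r.
have dS : 2 * d * S ^+ 3 <= 1.
  rewrite -(@ler_pM2r _ S)// mul1r (_ : _ * S = 2 * (d * S ^+ 4)); last by ring.
  by rewrite dA (le_trans _ S2)// ler_piMr.
(* On the annulus between the radii [2] and [S / 2] the step is at least [d]. *)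
pose beta := d ^+ 2 * (eps / 2).
have beta0 : 0 < beta by apply: mulr_gt0; [exact: exprn_gt0|exact: divr_gt0].
pose m := Num.Def.archi_bound (S ^+ 2 / (beta / 2)).
have mS : S ^+ 2 < m%:R * (beta / 2).
  rewrite -ltr_pdivrMr ?divr_gt0// archi_boundP//.
  by apply: divr_ge0; [exact: sqr_ge0|apply: divr_ge0 => //; exact: ltW].
have m0 : 0 < m%:R :> R.
  rewrite lt_neqAle ler0n andbT; apply/eqP => m0; move: mS; rewrite -m0 mul0r.
  by rewrite ltNge sqr_ge0.
pose eta := Num.min (beta / 2) (Num.min (b / 2) 4^-1 / m%:R).
have eta0 : 0 < eta by rewrite lt_min !divr_gt0//= lt_min !divr_gt0//=.
have eta1 : eta <= beta / 2 by rewrite ge_min lexx.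
have eta2 : m%:R * eta <= Num.min (b / 2) 4^-1.
  by rewrite mulrC -ler_pdivlMr// ge_min lexx orbT.
have eta3 : m%:R * eta <= b / 2 by rewrite (le_trans eta2)// ge_min lexx.
have eta4 : m%:R * eta <= 4^-1 by rewrite (le_trans eta2)// ge_min lexx orbT.
have [h [hS h0 hB hL hV]] := walk_run S d K beta eta Phi m K1 KS d0 dS tPhi eta0 PhiK.
rewrite dA in hB hL; set W := gap Phi h in hS hL hV.
have tW : trig W by exact: trig_gap.
have tW2 := tameX _ 2 (tame_normc _ tW).
have ts2 := tameX _ 2 (tame_step S d _ tW).
have tL := tame_logplus _ tW.
have U : mean (fun z => normc (W z) ^+ 2) <= S ^+ 2.
  rewrite -[leRHS](@mean_cst _ n) le_mean//; first exact: tame_cst.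
  by move=> z zT; apply: lerXn2r; rewrite ?nnegrE ?normc_ge0 ?hS// (ltW S0).
have V : mean (fun z => step S d (W z) ^+ 2) <= beta.
  case: hV => // hV; exfalso.
  have : m%:R * (beta / 2) <= m%:R * (beta - eta) by rewrite ler_wpM2l ?(ltW m0)//; lra.
  by move=> /le_trans/(_ hV)/le_trans/(_ U); rewrite leNgt mS.
have L : mean (fun z => logplus (W z)) <= ln K + 1.
  apply: (le_trans hL).
  have A21 : A ^+ 2 <= 1 by rewrite expr_le1// ltW.
  have AS2 : A ^+ 2 * S ^+ 2 <= 1.
    by rewrite -exprMn expr_le1//; apply: mulr_ge0; exact: ltW.
  apply: (log_budget _ _ _ _ _ _ AS2 A21 eta4).
  by apply: ler_wpM2l; [exact: sqr_ge0|exact: lerD].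
pose E0 := T `&` [set z | (normc (W z) <= 2)%R].
pose E1 := T `&` [set z | (q <= logplus (W z))%R].
pose E2 := T `&` [set z | (d ^+ 2 <= step S d (W z) ^+ 2)%R].
have mE1 : measurable E1 by apply: measurable_superlevel; exact: tL.1.
have mE2 : measurable E2 by apply: measurable_superlevel; exact: ts2.1.
have mE0 : measurable E0.
  rewrite /E0 (_ : [set z | _] = [set z | (- 2 <= - normc (W z))%R]); last first.
    by apply/seteqP; split => z /=; rewrite lerN2.
  by apply: measurable_superlevel; apply: measurableT_comp => //; exact: trig_normc_measurable.
have sE1 : (s E1 <= (eps / 2)%:E)%E.
  apply: markov_sigma => //; first by move=> z _; exact: logplus_ge0.
  by apply: (le_trans L); rewrite /q le_eqVlt; apply/orP; left; apply/eqP; field; rewrite gt_eqF.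
have sE2 : (s E2 <= (eps / 2)%:E)%E.
  by apply: markov_sigma => //; [move=> z _; exact: sqr_ge0|exact: exprn_gt0].
have cover : T `<=` E0 `|` (E1 `|` E2).
  move=> z zT; have wS := hS z zT; set w := normc (W z) in wS *.
  have [w2|w2] := leP w 2; first by left.
  right; have [w3|w3] := leP (S / 2) w.
    left; split => //=; have w0 : 1 <= normc (W z) by rewrite -/w; lra.
    rewrite (logplus_large _ w0) -[q]expRK ler_ln ?posrE ?expR_gt0//; last first.
      exact: lt_le_trans ltr01 w0.
    by apply: le_trans w3; rewrite /S; lra.
  right; split => //=; have st : d <= step S d (W z).
    rewrite /step -/w -mulrA ler_peMr ?(ltW d0)//.
    have w22 : 4 <= w ^+ 2.
      have -> : 4 = 2 ^+ 2 :> R by ring.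
      by apply: lerXn2r; rewrite ?nnegrE ?normc_ge0 ?ltW.
    have Sw : w ^+ 2 <= S ^+ 2 / 4.
      have -> : S ^+ 2 / 4 = (S / 2) ^+ 2 by field.
      by apply: lerXn2r; rewrite ?nnegrE ?normc_ge0 ?ltW// divr_gt0.
    apply: (@le_trans _ _ (1 * 1)); first by rewrite mulr1.
    by apply: ler_pM => //; lra.
  by apply: lerXn2r; rewrite ?nnegrE// ?(ltW d0)// (le_trans _ st) ?ltW.
exists E0, h; split => //.
- by move=> z [].
- have : (s T <= s E0 + (s E1 + s E2))%E.
    apply: (@le_trans _ _ (s (E0 `|` (E1 `|` E2)))).
      have mT := @measurable_torus R n.+1.
      by apply: le_measure => //; rewrite inE//; do 2?apply: measurableU.
    apply: le_trans (measureU2 _ _ _) _ => //; first exact: measurableU.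
    by apply: leeD2l; exact: measureU2.
  rewrite [X in (X <= _)%E -> _]sigma_torus => K2.
  have : (1 <= s E0 + eps%:E)%E.
    apply: (le_trans K2); apply: leeD2l; rewrite [eps]splitr EFinD; exact: leeD.
  case: (s E0) => [p| |].
  + by rewrite -EFinD !lee_fin lerBlDr.
  + by move=> _; exact: leey.
  + by rewrite addNye leeNy_eq.
- split=> [k z zD|z [_ //]].
  apply: (le_trans (hB k z zD)); rewrite (splitr b); exact: lerD.
Qed.

End correction.

(** * The theorem *)

Section scaling.
Context {R : realType} {N : nat}.
Local Notation point := 'rV[R[i]]_N.

Lemma bloch_coefZ (c : R[i]) (h : mpoly.mpoly N R[i]) k (z : point) :
  bloch_coef (poly_fun (mpoly.mpolyC _ c * h)) k z =
  normc c * bloch_coef (poly_fun h) k z.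
Proof.
have [p pE] := poly_fun_slice h k z.
have [_ E1] := partialE _ _ _ _ pE.
have [|_ E2] := partialE (poly_fun (mpoly.mpolyC _ c * h)) k z (c *: p).
  by move=> t; rewrite poly_funM hornerZ -pE /poly_fun mpoly.mevalC.
by rewrite /bloch_coef E1 E2 derivZ hornerZ normcM mulrCA.
Qed.

Lemma bloch_norm_addr (f g : point -> R[i]) (a b : R) :
  (forall k z, polydisc N z -> derivable f z (delta_mx 0 k)) ->
  (forall k z, polydisc N z -> derivable g z (delta_mx 0 k)) ->
  g 0 = 0 ->
  (forall z, polydisc N z -> \sum_k bloch_coef g k z <= b) ->
  (bloch_norm f <= a%:E)%E -> (bloch_norm (f \+ g)%R <= (a + b)%:E)%E.
Proof.
move=> df dg g0 gb.
pose s (u : point -> R[i]) :=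
  ereal_sup [set (\sum_k bloch_coef u k z)%:E | z in polydisc N].
have sE u : bloch_norm u = ((normc (u 0))%:E + s u)%E by [].
have fg0 : normc ((f \+ g)%R 0) = normc (f 0) by rewrite /= g0 addr0.
have sfg : (s (f \+ g)%R <= s f + b%:E)%E.
  apply: ge_ereal_sup => _ [z zD <-].
  apply: (@le_trans _ _ ((\sum_k bloch_coef f k z)%:E + b%:E)%E).
    rewrite -EFinD lee_fin; apply: (le_trans _ (lerD (lexx _) (gb z zD))).
    rewrite -big_split; apply: ler_sum => k _.
    by apply: bloch_coefD => //; [exact: df|exact: dg].
  by apply: leeD2r; apply: ereal_sup_ubound; exists z.
rewrite !sE fg0 => fa; apply: (le_trans (leeD2l _ sfg)).
by rewrite addeA EFinD; exact: leeD2r.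
Qed.

End scaling.

Theorem lemma2p5 (R : realType) (N : nat) (eps : R)
    (g phi : 'rV[R[i]]_N -> R[i]) :
  (1 <= N)%N -> 0 < eps -> little_bloch g ->
  {within torus N, continuous phi} ->
  exists (E : set 'rV[R[i]]_N) (f : mpoly.mpoly N R[i]),
    [/\ measurable E, E `<=` torus N, ((1 - eps)%:E <= sigma N E)%E,
        (bloch_norm (poly_fun f \- g)%R <= eps%:E)%E
      & (sup_norm E (poly_fun f \- phi)%R <= eps%:E)%E].
Proof.
case: N g phi => // n g phi _ eps0 [[holg _] apx] cphi.
have e20 : 0 < eps / 2 by rewrite divr_gt0.
have e40 : 0 < eps / 4 by rewrite divr_gt0.
have [p pg] := apx _ e20.
have [f1 tf1 f1phi] := trig_dense phi _ cphi e20.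
(* Scaling by [eps / 4] turns the bound [2] of the correction into [eps / 2]. *)
pose c : R[i] := (eps / 4)%:C%C.
have nc : normc c = eps / 4 by rewrite normcC gtr0_norm.
have c0 : c != 0 by rewrite -normc_gt0 nc.
pose Phi z := c^-1 * (f1 z + - poly_fun p z).
have tPhi : trig Phi.
  apply: trigM; first exact: trig_cst.
  by apply: trigD => //; apply: trigN; exact: trig_poly_fun.
have N0 : 0 < n.+1%:R :> R by rewrite ltr0n.
have [E [h [mE ET sE h0 [hB hE]]]] := trig_correction _ _ (2 / n.+1%:R) tPhi eps0
  ltac:(by rewrite divr_gt0).
exists E, (p + mpoly.mpolyC _ c * h); split => //.
- have -> : (poly_fun (p + mpoly.mpolyC _ c * h) \- g)%R =
    (poly_fun p \- g) \+ poly_fun (mpoly.mpolyC _ c * h).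
    by apply/funext => z; rewrite poly_funD /= addrAC.
  rewrite (splitr eps); apply: bloch_norm_addr.
  + move=> k z zD; apply: derivableB; first exact: poly_fun_derivable.
    exact/diff_derivable/holg.
  + by move=> k z _; exact: poly_fun_derivable.
  + by rewrite poly_funM h0 mulr0.
  + move=> z zD; apply: (@le_trans _ _ (\sum_(k < n.+1) eps / 4 * (2 / n.+1%:R))).
      apply: ler_sum => k _; rewrite bloch_coefZ nc ler_wpM2l ?(ltW e40)//.
      exact: hB.
    rewrite sumr_const card_ord -[leLHS]mulr_natl le_eqVlt; apply/orP; left.
    by apply/eqP; field; rewrite gt_eqF.
  + exact: ltW.
- apply: ge_ereal_sup => _ [z zE <-]; rewrite lee_fin.
  rewrite poly_funD /= poly_funM.
  have -> : poly_fun (mpoly.mpolyC _ c) z = c by rewrite /poly_fun mpoly.mevalC.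
  have -> : poly_fun p z + c * poly_fun h z - phi z =
      (f1 z - phi z) - c * (Phi z - poly_fun h z).
    by rewrite mulrBr /Phi mulVKf//; ring.
  rewrite (splitr eps) (le_trans (normcB _ _))// lerD ?f1phi//; first exact: ET.
  rewrite normcM nc; apply: (@le_trans _ _ (eps / 4 * 2)).
    by rewrite ler_wpM2l ?(ltW e40)// hE.
  lra.
Qed.
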